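(* Let $\psi:\mathbb R^n\to\overline{\mathbb R}$ be finite at $\bar x\in\mathbb R^n$, and suppose that there is a neighborhood $\mathcal O$ of $\bar x$ such that $\psi(x)=g(F(x))$ for all $x\in\mathcal O$, where $F:\mathbb R^n\to\mathbb R^m$ is twice differentiable at $\bar x$ in the extended sense and $g:\mathbb R^m\to\overline{\mathbb R}$ is proper, lower semicontinuous, convex, and Lipschitz continuous around $F(\bar x)$ relative to its domain. Suppose the metric subregularity qualification condition holds at $\bar x$: there exist $\kappa\ge0$ and a neighborhood $U$ of $\bar x$ such that $d(x,\operatorname{dom}\psi)\le\kappa\,d(F(x),\operatorname{dom}g)$ for all $x\in U$. Then $$d\psi(\bar x)(w)=dg(F(\bar x))(\nabla F(\bar x)w)\ \text{ for all } w\in\mathbb R^n,\qquad \partial_p\psi(\bar x)=\partial\psi(\bar x)=\nabla F(\bar x)^*\partial g(F(\bar x)),$$ and $T_{\operatorname{dom}\psi}(\bar x)=\{w\in\mathbb R^n\mid\nabla F(\bar x)w\in T_{\operatorname{dom}g}(F(\bar x))\}$. If, in addition, $w\in T_{\operatorname{dom}\psi}(\bar x)$ and $g$ is parabolically epi-differentiable at $F(\bar x)$ for $\nabla F(\bar x)w$, then: (i) $z\in T^2_{\operatorname{dom}\psi}(\bar x,w)\iff\nabla F(\bar x)z+\nabla^2F(\bar x)(w,w)\in T^2_{\operatorname{dom}g}(F(\bar x),\nabla F(\bar x)w)$, and $\operatorname{dom}\psi$ is parabolically derivable at $\bar x$ for $w$; (ii) $d^2\psi(\bar x)(w|z)=d^2g(F(\bar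 x))\big(\nabla F(\bar x)w\,\big|\,\nabla F(\bar x)z+\nabla^2F(\bar x)(w,w)\big)$ for all $z\in\mathbb R^n$; (iii) $\operatorname{dom}d^2\psi(\bar x)(w|\cdot)=T^2_{\operatorname{dom}\psi}(\bar x,w)$; (iv) $\psi$ is parabolically epi-differentiable at $\bar x$ for $w$.
   Context: $\overline{\mathbb R}:=\mathbb R\cup\{\infty\}$; $\operatorname{dom}f=\{x:f(x)<\infty\}$; $d(x,\Omega)$ is the distance to a set. Extended twice differentiability: $f:\mathbb R^n\to\overline{\mathbb R}$, finite at $\bar x$, is twice differentiable at $\bar x$ in the extended sense if it is differentiable at $\bar x$ and there exist an $n\times n$ matrix $A$, a neighborhood $U$ of $\bar x$ and $D\subset U$ with $\mu(U\setminus D)=0$ ($\mu$ Lebesgue measure) such that $f$ is Lipschitz on $U$, differentiable at every point of $D$, and $\lim_{x\to\bar x,\,x\in D}\frac{\nabla f(x)-\nabla f(\bar x)-A(x-\bar x)}{\|x-\bar x\|}=0$; the unique $A$ is denoted $\nabla^2f(\bar x)$. A mapping $F=(F_1,\dots,F_m)$ is twice differentiable at $\bar x$ in the extended sense if each $F_i$ is, and $\nabla^2F(\bar x)(w,v):=(\langle\nabla^2F_1(\bar x)w,v\rangle,\dots,\langle\nabla^2F_m(\bar x)w,v\rangle)$. $\nabla F(\bar x)^*$ is the adjoint (transpose) of the Jacobian. $g$ is Lipschitz continuous around $F(\bar x)$ relative to its domain (with constant $\ell\ge0$) if there is a neighborhood $\mathcal V$ of $F(\bar x)$ with $|g(y_1)-g(y_2)|\le\ell\|y_1-y_2\|$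 for all $y_1,y_2\in\operatorname{dom}g\cap\mathcal V$. Subdifferentials at $\bar x\in\operatorname{dom}f$: proximal, $\partial_pf(\bar x)=\{v:\liminf_{x\to\bar x}\frac{f(x)-f(\bar x)-\langle v,x-\bar x\rangle}{\|x-\bar x\|^2}>-\infty\}$; regular, $\widehat\partial f(\bar x)=\{v:\liminf_{x\to\bar x}\frac{f(x)-f(\bar x)-\langle v,x-\bar x\rangle}{\|x-\bar x\|}\ge0\}$; limiting, $\partial f(\bar x)$ = set of $v$ for which there are $x_k\to\bar x$ with $f(x_k)\to f(\bar x)$ and $v_k\to v$ with $v_k\in\widehat\partial f(x_k)$. Subderivative: $df(\bar x)(w)=\liminf_{t\downarrow0,\,w'\to w}\frac{f(\bar x+tw')-f(\bar x)}{t}$. Parabolic subderivative (for $w$ with $df(\bar x)(w)\in\mathbb R$): $d^2f(\bar x)(w|z)=\liminf_{t\downarrow0,\,z'\to z}\frac{f(\bar x+tw+\frac12t^2z')-f(\bar x)-t\,df(\bar x)(w)}{\frac12t^2}$, with $\operatorname{dom}d^2f(\bar x)(w|\cdot)=\{z:d^2f(\bar x)(w|z)<\infty\}$. $f$ is parabolically epi-differentiable at $\bar x$ for $w$ if $\operatorname{dom}d^2f(\bar x)(w|\cdot)\neq\emptyset$ and for every $z\in\mathbb R^n$ and every $t_k\downarrow0$ there is $z_k\to z$ with $d^2f(\bar x)(w|z)=\liminf_{k\to\infty}\frac{f(\bar x+t_kw+\frac12t_k^2z_k)-f(\bar x)-t_k\,df(\bar x)(w)}{\frac12t_k^2}$.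 Tangent cone: $T_\Omega(\bar x)=\{v:\exists t_k\downarrow0,\ v_k\to v,\ \bar x+t_kv_k\in\Omega\ \forall k\}$. Second-order tangent set for $w\in T_\Omega(\bar x)$: $T^2_\Omega(\bar x,w)=\{u:\exists t_k\downarrow0,\ u_k\to u,\ \bar x+t_kw+\frac12t_k^2u_k\in\Omega\ \forall k\}$. $\Omega$ is parabolically derivable at $\bar x$ for $w$ if $T^2_\Omega(\bar x,w)\ne\emptyset$ and for each $u\in T^2_\Omega(\bar x,w)$ there are $\varepsilon>0$ and $\xi:[0,\varepsilon]\to\Omega$ with $\xi(0)=\bar x$, $\xi'_+(0)=w$, $\xi''_+(0)=u$, where $\xi'_+(0)=\lim_{t\downarrow0}\frac{\xi(t)-\xi(0)}{t}$ and $\xi''_+(0)=\lim_{t\downarrow0}\frac{\xi(t)-\xi(0)-t\xi'_+(0)}{\frac12t^2}$. *)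

(* Defs.v *)
From HB Require Import structures.
From mathcomp Require Import all_boot all_order all_algebra.
From mathcomp Require Import all_classical all_reals all_analysis.

Set Implicit Arguments.
Unset Strict Implicit.
Unset Printing Implicit Defensive.

Import Order.TTheory GRing.Theory Num.Theory.
Import numFieldNormedType.Exports.

Local Open Scope classical_set_scope.
Local Open Scope ring_scope.

(* R^n is 'rV[R]_n.  Vectors are rows, so a matrix A acts on v as v *m A^T; the
   library's Jacobian 'J F x is already transposed: the Jacobian of F at x
   applied to w is w *m 'J F x, and its adjoint sends y to y *m ('J F x)^T. *)

Section Euclidean.
Context {R : realType} {n : nat}.
Implicit Types (u v x : 'rV[R]_n) (A Omega : set 'rV[R]_n).

Definition dot u v : R := \sum_(i < n) u 0 i * v 0 i.

(* `|v| is the sup norm on 'rV[R]_n; it induces the same topology. *)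
Definition enorm v : R := Num.sqrt (dot v v).

(* Equal to +oo when Omega is empty. *)
Definition dist_set x Omega : \bar R :=
  ereal_inf [set (enorm (x - y))%:E | y in Omega].

Definition box (a b : 'rV[R]_n) : set 'rV[R]_n :=
  [set x | forall i, a 0 i <= x 0 i <= b 0 i].

Definition box_volume (a b : 'rV[R]_n) : R := \prod_(i < n) (b 0 i - a 0 i).

(* Lebesgue outer measure; the sets of Lebesgue measure zero are exactly those
   of outer measure zero.  Covers are indexed by a subset P of nat so that
   finite and empty covers are allowed (a box of R^0 has volume 1). *)
Definition lebesgue_outer A : \bar R :=
  ereal_inf [set s : \bar R | exists (P : set nat) (a b : nat -> 'rV[R]_n),
    [/\ forall k, P k -> forall i, a k 0 i <= b k 0 i,
        A `<=` \bigcup_(k in P) box (a k) (b k) &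
        s = \esum_(k in P) (box_volume (a k) (b k))%:E]].

End Euclidean.

Section TwiceDifferentiability.
Context {R : realType} {n : nat}.
Implicit Types (f : 'rV[R]_n -> R) (x : 'rV[R]_n) (A : 'M[R]_n).

Definition gradient f x : 'rV[R]_n := \row_i 'd f x (delta_mx 0 i).

Definition lipschitz_on (U : set 'rV[R]_n) f : Prop :=
  exists L : R, 0 <= L /\
    forall y z, U y -> U z -> `|f y - f z| <= L * enorm (y - z).

Definition is_ext_hessian f x A : Prop :=
  differentiable f x /\
  exists U D : set 'rV[R]_n,
    nbhs x U /\ D `<=` U /\ lebesgue_outer (U `\` D) = 0%E /\
    lipschitz_on U f /\ (forall y, D y -> differentiable f y) /\
    (fun y => (enorm (y - x))^-1 *:
      (gradient f y - gradient f x - (y - x) *m A^T)) @ within D x^'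
      --> (0 : 'rV[R]_n).

Definition ext_twice_differentiable f x : Prop :=
  exists A, is_ext_hessian f x A.

Definition ext_hessian f x : 'M[R]_n := xget 0 [set A | is_ext_hessian f x A].

End TwiceDifferentiability.

Section TwiceDifferentiabilityMap.
Context {R : realType} {n m : nat}.
Implicit Types (F : 'rV[R]_n -> 'rV[R]_m) (x w v : 'rV[R]_n).

Definition ext_twice_differentiable_map F x : Prop :=
  forall i : 'I_m, ext_twice_differentiable (fun y => F y 0 i) x.

Definition ext_hessian_map F x w v : 'rV[R]_m :=
  \row_i dot (w *m (ext_hessian (fun y => F y 0 i) x)^T) v.

End TwiceDifferentiabilityMap.

Section ExtendedRealFunctions.
Context {R : realType} {n : nat}.
Implicit Types (f : 'rV[R]_n -> \bar R) (x v w z : 'rV[R]_n).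
Local Open Scope ereal_scope.

Definition edom f : set 'rV[R]_n := [set x | f x < +oo].

(* Encodes f : R^n -> R u {+oo}. *)
Definition nowhereNy f : Prop := forall x, f x != -oo.

Definition proper_ext f : Prop := nowhereNy f /\ edom f !=set0.

(* Meant for functions that nowhere take the value -oo, so that the right-hand
   side is never of the form +oo - oo; 0 * +oo = 0. *)
Definition convex_ext f : Prop := forall x y (t : R), (0 <= t <= 1)%R ->
  f (t *: x + (1 - t) *: y)%R <= t%:E * f x + (1 - t)%:E * f y.

Definition lipschitz_rel_dom f x : Prop :=
  exists l : R, (0 <= l)%R /\ exists V : set 'rV[R]_n, nbhs x V /\
    forall y1 y2, (edom f `&` V) y1 -> (edom f `&` V) y2 ->
      `|f y1 - f y2| <= (l * enorm (y1 - y2)%R)%:E.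

Definition proximal_subdiff f x : set 'rV[R]_n :=
  [set v | edom f x /\
    -oo < limf_einf (fun y => (f y - f x - (dot v (y - x)%R)%:E) *
                              ((enorm (y - x)%R ^+ 2)^-1)%:E) x^'].

Definition regular_subdiff f x : set 'rV[R]_n :=
  [set v | edom f x /\
    0 <= limf_einf (fun y => (f y - f x - (dot v (y - x)%R)%:E) *
                             ((enorm (y - x)%R)^-1)%:E) x^'].

Definition limiting_subdiff f x : set 'rV[R]_n :=
  [set v | edom f x /\ exists xk vk : nat -> 'rV[R]_n,
    [/\ xk @ \oo --> x, (fun k => f (xk k)) @ \oo --> f x,
        vk @ \oo --> v & forall k, regular_subdiff f (xk k) (vk k)]].

Definition subderivative f x w : \bar R :=
  limf_einf (fun p : R * 'rV[R]_n =>
      (f (x + p.1 *: p.2)%R - f x) * (p.1^-1)%:E)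
    (filter_prod 0%R^'+ (nbhs w)).

Definition parabolic_quotient f x w (t : R) z : \bar R :=
  (f (x + t *: w + (2^-1 * t ^+ 2) *: z)%R - f x - t%:E * subderivative f x w) *
  ((2^-1 * t ^+ 2)^-1)%:E.

(* Meaningful only if subderivative f x w is finite. *)
Definition parabolic_subderivative f x w z : \bar R :=
  limf_einf (fun p : R * 'rV[R]_n => parabolic_quotient f x w p.1 p.2)
    (filter_prod 0%R^'+ (nbhs z)).

Definition down_to0 (t : nat -> R) : Prop :=
  (forall k, 0 < t k)%R /\ t @ \oo --> 0%R.

Definition parabolically_epi_differentiable f x w : Prop :=
  subderivative f x w \is a fin_num /\
  edom (parabolic_subderivative f x w) !=set0 /\
  forall z (t : nat -> R), down_to0 t ->
    exists zk : nat -> 'rV[R]_n, zk @ \oo --> z /\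
      parabolic_subderivative f x w z =
        limn_einf (fun k => parabolic_quotient f x w (t k) (zk k)).

End ExtendedRealFunctions.

Section TangentSets.
Context {R : realType} {n : nat}.
Implicit Types (Omega : set 'rV[R]_n) (x u v w : 'rV[R]_n).

Definition tangent_cone Omega x : set 'rV[R]_n :=
  [set v | exists (t : nat -> R) (vk : nat -> 'rV[R]_n),
    [/\ down_to0 t, vk @ \oo --> v & forall k, Omega (x + t k *: vk k)]].

Definition second_order_tangent_set Omega x w : set 'rV[R]_n :=
  [set u | exists (t : nat -> R) (uk : nat -> 'rV[R]_n),
    [/\ down_to0 t, uk @ \oo --> u &
        forall k, Omega (x + t k *: w + (2^-1 * t k ^+ 2) *: uk k)]].

(* Only the values of xi on [0, eps] matter. *)
Definition parabolically_derivable Omega x w : Prop :=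
  second_order_tangent_set Omega x w !=set0 /\
  forall u, second_order_tangent_set Omega x w u ->
    exists (eps : R) (xi : R -> 'rV[R]_n),
      [/\ 0 < eps, forall t, 0 <= t <= eps -> Omega (xi t), xi 0 = x,
          (fun t : R => t^-1 *: (xi t - xi 0)) @ 0^'+ --> w &
          (fun t : R => (2^-1 * t ^+ 2)^-1 *: (xi t - xi 0 - t *: w)) @ 0^'+
            --> u].

End TangentSets.

(* Main.v *)
(* A translate of any segment meets the null set of non-differentiability in a
   set of small length (average over the translates, one coordinate at a time).
   Integrating the gradient along translated segments therefore shows that F is
   strictly differentiable at xbar and has a second-order expansion there.

   If y is in dom g and close to F x, metric subregularity provides x' in dom psi
   with |x - x'| <= K |F x - y|, and the Lipschitz continuity of g on its domain
   gives psi x' <= g y + l |F x' - y|.  With x = xbar + t w, resp.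
   x = xbar + t w + t^2/2 z, this lifts every first-, resp. second-order, curve in
   dom g to one in dom psi at cost o(t), resp. o(t^2), whence the formulas for
   (parabolic) subderivatives and tangent sets.

   For the subdifferential, g is replaced near F xbar by its Lipschitz
   regularization Phi; with a large constant, a regular subgradient of psi at x_k
   is an approximate one of Phi o F, by exact penalization.  Strict
   differentiability and convexity pass to the limit, and the Hahn-Banach theorem
   yields v = J^* y with y a subgradient of g.  The converse inclusion, into the
   proximal subdifferential, is the second-order expansion of F. *)

Require Import Defs.
From HB Require Import structures.
From mathcomp Require Import all_boot all_order all_algebra.
From mathcomp Require Import all_classical all_reals all_analysis measurable_realfun.
From mathcomp Require Import ring lra.
Import Order.TTheory GRing.Theory Num.Theory.
Import numFieldNormedType.Exports.
Local Open Scope classical_set_scope.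
Local Open Scope ring_scope.

(** * Norms and inner products *)

Section Norms.
Context {R : realType}.

(** The gradients of the coordinates of F are controlled only on a set D of full measure, and a
    given segment may miss D altogether, so integration along the segment itself gives nothing. The
    points x_k of a limiting subgradient need not be points of differentiability of F, so no chain
    rule is available at x_k. Strict differentiability at xbar replaces it, at the cost of an error
    e * |h| that is removed only at the end. Making the resulting local inequality global requires a
    convex function that is finite everywhere, whereas g is controlled only on its domain near F
    xbar: hence Phi, whose slope M has to be the same for all k. At second order, a vector tangent
    to dom g need not have the form z *m J + H(w, w). A second-order tangent vector of dom psi is
    obtained instead as a cluster point of corrections which metric subregularity keeps bounded at
    the scale t^2 / 2. Estimates are made in the sup norm; the dimension factors come from
    [enorm_le_norm], [dot_norm] and [mulmx_norm]. *)

Lemma exists_below (a b c : R) : 0 < a -> 0 < b -> 0 < c ->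
  exists q, [/\ 0 < q, q <= a, q <= b & q <= c].
Proof.
move=> a0 b0 c0; exists (Num.min a (Num.min b c)).
by rewrite !lt_min a0 b0 c0 !ge_min !lexx !orbT.
Qed.

Lemma mx_norm_ge m n (A : 'M[R]_(m, n)) i j : `|A i j| <= `|A|.
Proof.
by rewrite [leRHS]mx_normrE; exact: (le_bigmax _ (fun ij => `|A ij.1 ij.2|) (i, j)).
Qed.

Lemma rV_norm_le n (u : 'rV[R]_n) r :
  0 <= r -> (forall i, `|u 0 i| <= r) -> `|u| <= r.
Proof.
move=> r0 ur; rewrite [leLHS]mx_normrE; apply: bigmax_le => // -[i j] _ /=.
by rewrite ord1.
Qed.

Lemma mulmx_norm n m (u : 'rV[R]_n) (A : 'M[R]_(n, m)) :
  `|u *m A| <= n%:R * `|A| * `|u|.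
Proof.
apply: rV_norm_le => [|j]; first by rewrite !mulr_ge0.
rewrite mxE (le_trans (ler_norm_sum _ _ _))//.
rewrite (@le_trans _ _ (\sum_(i < n) `|A| * `|u|))//.
  apply: ler_sum => i _; rewrite normrM mulrC.
  by apply: ler_pM => //; exact: mx_norm_ge.
by rewrite sumr_const card_ord -mulrA mulr_natl.
Qed.

Section Dot.
Context {n : nat}.
Implicit Types u v w : 'rV[R]_n.

Lemma dotE u v : dot u v = (u *m v^T) 0 0.
Proof. by rewrite mxE; apply: eq_bigr => i _; rewrite mxE. Qed.

Lemma dotC u v : dot u v = dot v u.
Proof. by apply: eq_bigr => i _; rewrite mulrC. Qed.

Lemma dotDr u v w : dot u (v + w) = dot u v + dot u w.
Proof. by rewrite -big_split; apply: eq_bigr => i _; rewrite mxE mulrDr. Qed.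

Lemma dotZr a u v : dot u (a *: v) = a * dot u v.
Proof. by rewrite mulr_sumr; apply: eq_bigr => i _; rewrite mxE mulrCA. Qed.

Lemma dotNr u v : dot u (- v) = - dot u v.
Proof. by rewrite -scaleN1r dotZr mulN1r. Qed.

Lemma dotBr u v w : dot u (v - w) = dot u v - dot u w.
Proof. by rewrite dotDr dotNr. Qed.

Lemma dot0r u : dot u 0 = 0.
Proof. by rewrite -(scale0r 0) dotZr mul0r. Qed.

Lemma dotDl u v w : dot (u + v) w = dot u w + dot v w.
Proof. by rewrite dotC dotDr !(dotC w). Qed.

Lemma dotZl a u v : dot (a *: u) v = a * dot u v.
Proof. by rewrite dotC dotZr (dotC v). Qed.

Lemma dotBl u v w : dot (u - v) w = dot u w - dot v w.
Proof. by rewrite dotC dotBr !(dotC w). Qed.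

Lemma dot_norm u v : `|dot u v| <= n%:R * `|u| * `|v|.
Proof.
rewrite (le_trans (ler_norm_sum _ _ _))//.
rewrite (@le_trans _ _ (\sum_(i < n) `|u| * `|v|))//.
  by apply: ler_sum => i _; rewrite normrM ler_pM//; exact: mx_norm_ge.
by rewrite sumr_const card_ord -mulrA mulr_natl.
Qed.

Lemma dot_ge0 u : 0 <= dot u u.
Proof. by apply: sumr_ge0 => i _; rewrite -expr2 sqr_ge0. Qed.

Lemma norm_le_enorm u : `|u| <= enorm u.
Proof.
apply: rV_norm_le => [|i]; first exact: sqrtr_ge0.
rewrite -sqrtr_sqr ler_sqrt ?dot_ge0// /dot (bigD1 i)//= -expr2 lerDl.
by apply: sumr_ge0 => j _; rewrite -expr2 sqr_ge0.
Qed.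

Lemma enorm_le_norm u : enorm u <= n%:R * `|u|.
Proof.
rewrite -[leRHS]ger0_norm ?mulr_ge0// -sqrtr_sqr ler_sqrt ?sqr_ge0//.
apply: le_trans (ler_norm _) _; apply: le_trans (dot_norm _ _) _.
have nn : n%:R <= n%:R * n%:R :> R.
  by rewrite -natrM ler_nat; case: (n) => // k; rewrite leq_pmulr.
by rewrite exprMn -mulrA -expr2 ler_wpM2r ?sqr_ge0// [leRHS]expr2.
Qed.

Lemma enorm_gt0 u : u != 0 -> 0 < enorm u.
Proof. by rewrite -normr_gt0 => /lt_le_trans; apply; exact: norm_le_enorm. Qed.

End Dot.
End Norms.

(** * Increments of Lipschitz functions across null sets *)

Section MeasureZero.
Context {R : realType}.
Local Notation mu := (@lebesgue_measure R).
Implicit Types (T E : set R).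

(** Here [p.1] is a shift of one coordinate of the segment and [p.2] is a time: the shifted
    coordinate lies in the side [al, be] of a box. [T] will be the set of times at which the earlier
    coordinates already lie in the box. *)
Definition slab T (al be a d eta : R) : set (R * R) :=
  [set p | [/\ `|p.1| <= eta, T p.2 & al <= a + p.1 + p.2 * d <= be]].

Lemma measurable_slab (T : set R) (al be a d eta : R) : measurable T ->
  measurable (slab T al be a d eta).
Proof.
move=> mT.
have -> : slab T al be a d eta =
  (fun p : R * R => p.1) @^-1` `[- eta, eta] `&` (fun p : R * R => p.2) @^-1` T `&`
  (fun p : R * R => a + p.1 + p.2 * d) @^-1` `[al, be].
  apply/seteqP; split=> -[s t]; rewrite /slab /= !in_itv/= ler_norml.
    by case.
  by case=> -[].
apply: measurableI; first apply: measurableI.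
- by rewrite -[X in measurable X]setTI; exact: measurable_fst.
- by rewrite -[X in measurable X]setTI; exact: measurable_snd.
- rewrite -[X in measurable X]setTI.
  apply: (_ : measurable_fun setT (fun p : R * R => a + p.1 + p.2 * d)) => //.
  apply: measurable_realfun.measurable_funD; first apply: measurable_realfun.measurable_funD => //.
  by apply: measurable_realfun.measurable_funM.
Qed.

(** Exchange the integrals: at a fixed time in T the admissible shifts lie in an interval of length
    be - al, and at other times there are none. *)
Lemma fubini_slab (T : set R) (al be a d eta : R) : measurable T -> al <= be ->
  (\int[mu]_s mu (xsection (slab T al be a d eta) s) <= (be - al)%:E * mu T)%E.
Proof.
move=> mT albe; set A := slab T al be a d eta.
have mA : measurable A by exact: measurable_slab.
have := indic_fubini_tonelli mu mu mA.
rewrite indic_fubini_tonelli_FE// indic_fubini_tonelli_GE// /comp => ->.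
have -> : ((be - al)%:E * mu T = \int[mu]_t ((be - al)%:E * (\1_T t)%:E))%E.
  rewrite ge0_integralZl_EFin//; last by rewrite subr_ge0.
    by rewrite integral_indic// setIT.
  exact/measurable_EFinP.
apply: ge0_le_integral => //.
- exact: measurable_fun_ysection.
- apply: emeasurable_funM => //; exact/measurable_EFinP.
move=> t _; rewrite indicE; case: (boolP (t \in T)) => [tT|/negP tT].
  rewrite mule1.
  have -> : (be - al)%:E = mu `[al - a - t * d, be - a - t * d].
    rewrite lebesgue_measure_itv/= lte_fin !ltrD2r.
    move: albe; rewrite le_eqVlt => /orP[/eqP->|->].
      by rewrite ltxx subrr.
    by rewrite -EFinB; congr EFin; ring.
  apply: le_measure; rewrite ?inE//; first exact: measurable_ysection.
  move=> s; rewrite /ysection/= inE /A/= in_itv/= => -[_ _ /=/andP[h1 h2]].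
  by apply/andP; split; lra.
rewrite mule0 (_ : ysection A t = set0) ?measure0//.
rewrite -subset0 => s; rewrite /ysection/= inE /A/= => -[_ Tt _].
by apply: tT; rewrite inE.
Qed.

(* The average over s in [-eta, eta] of the sum in the conclusion is at most
   e / (2 * eta). *)
Lemma slab_selection (T : nat -> set R) (c al be : nat -> R) (a d eta e : R) :
  0 < eta -> 0 < e -> (forall k, measurable (T k)) -> (forall k, 0 <= c k) ->
  (forall k, al k <= be k) ->
  (\sum_(0 <= k <oo) (c k * (be k - al k))%:E * mu (T k) <= e%:E)%E ->
  exists s, `|s| <= eta /\
    (\sum_(0 <= k <oo) (c k)%:E *
      mu (T k `&` [set t | (al k <= a + s + t * d <= be k)%R]) <= (e / eta)%:E)%E.
Proof.
move=> eta0 e0 mT c0 albe sume; apply: contrapT => /forallNP noS.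
pose A k := slab (T k) (al k) (be k) a d eta.
have mA k : measurable (A k) by exact: measurable_slab.
have mG k : measurable_fun setT (fun s => mu (xsection (A k) s)).
  exact: (measurable_fun_xsection mu (mA k)).
have IE : (\int[mu]_s \sum_(0 <= k <oo) (c k)%:E * mu (xsection (A k) s) =
    \sum_(0 <= k <oo) \int[mu]_s ((c k)%:E * mu (xsection (A k) s)))%E.
  apply: integral_nneseries => //; first by move=> k; exact: (emeasurable_funM (measurable_cst _) (mG k)).
  by move=> k s _; rewrite mule_ge0// lee_fin.
(* The right side of [IE] is at most e by [fubini_slab]; if every shift failed, the left side would
   be at least e / eta times the length 2 * eta, hence larger than e. *)
move/eqP: IE; apply/negP; rewrite gt_eqF//.
apply: (@le_lt_trans _ _ e%:E).
  apply: le_trans sume; apply: lee_nneseries => k _.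
    by move=> _; apply: integral_ge0 => s _; rewrite mule_ge0// lee_fin.
  have -> := ge0_integralZl_EFin mu measurableT (fun s _ => measure_ge0 mu (xsection (A k) s)) (mG k) (c0 k).
  rewrite EFinM -muleA.
  by rewrite lee_wpmul2l ?lee_fin//; exact: fubini_slab.
have mS : measurable_fun setT
    (fun s => \sum_(0 <= k <oo) (c k)%:E * mu (xsection (A k) s))%E.
  apply: ge0_emeasurable_sum => [k s _ _|k _]; last exact: (emeasurable_funM (measurable_cst _) (mG k)).
  by rewrite mule_ge0// lee_fin.
pose I : set R := [set` `[- eta, eta]].
have muI : mu I = (eta + eta)%:E.
  by rewrite lebesgue_measure_itv/= lte_fin ifT -?EFinB ?opprK//; lra.
have mI : measurable I by exact: measurable_itv.
have lt_e : (e%:E < \int[mu]_(s in I) (cst (e / eta)%:E s))%E.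
  apply: (@lt_le_trans _ _ ((e / eta)%:E * mu I)%E); last by rewrite integral_cst.
  rewrite muI -EFinM lte_fin mulrDr divfK ?gt_eqF//; lra.
apply: (lt_le_trans lt_e).
apply: (@le_trans _ _ (\int[mu]_(s in I)
    (\sum_(0 <= k <oo) (c k)%:E * mu (xsection (A k) s)))%E); last first.
  apply: ge0_subset_integral => // s _; apply: nneseries_ge0 => k _ _.
  by rewrite mule_ge0// lee_fin.
apply: ge0_le_integral => //.
- by move=> s _; rewrite lee_fin divr_ge0// ltW.
- exact: measurable_funTS.
move=> s; rewrite /I/= in_itv/= -ler_norml => sE.
have := noS s; move/not_andP => -[//|/negP]; rewrite -ltNge => /ltW.
congr (_ <= _)%E; apply: eq_eseriesr => k _; congr (_ * mu _)%E.
apply/seteqP; split => t; rewrite /xsection/= inE/=.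
  by case=> Tt ht; split.
by case.
Qed.

End MeasureZero.

(** * Translates of a segment that nearly avoid a null set *)

Section NullSet.
Context {R : realType}.
Local Notation mu := (@lebesgue_measure R).
(** The coordinates of u are fixed one after another by [slab_selection]. Each choice removes one
    side length from the weight of box k and instead restricts the times to those at which that
    coordinate lies in the box, at the price of a factor 1 / eta. After n choices the weights are 1
    and only the measure of times is left. *)
Lemma avoid_null_set n (N : set 'rV[R]_n) (a d : 'rV[R]_n) (eta delta : R) :
  lebesgue_outer N = 0%E -> 0 < eta -> 0 < delta ->
  exists u E, [/\ `|u| <= eta, measurable E, (mu E <= delta%:E)%E &
    forall t, 0 <= t <= 1 -> N (a + u + t *: d) -> E t].
Proof.
move=> N0 eta0 delta0.
(* The n choices divide this bound by eta ^+ n, which leaves delta. *)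
have e0 : 0 < delta * eta ^+ n by rewrite mulr_gt0// exprn_gt0.
have : (lebesgue_outer N < (delta * eta ^+ n)%:E)%E by rewrite N0 lte_fin.
move=> /ereal_inf_lt[_ [P [al0 [be0 [albe0 cov ->]]]] vol].
(* Outside [P] the sides become [0, 0], so that endpoints are ordered for every index and the sum
   over [P] becomes a series; those indices contribute nothing, since [T] requires [P k]. *)
pose al k i := if k \in P then al0 k 0 i else 0.
pose be k i := if k \in P then be0 k 0 i else 0.
have albe k i : al k i <= be k i.
  by rewrite /al /be; case: ifPn => //; rewrite inE => /albe0; exact.
pose T k j (u : 'rV[R]_n) : set R := [set t | [/\ P k, 0 <= t <= 1 &
  forall i : 'I_n, (i < j)%N -> al k i <= a 0 i + u 0 i + t * d 0 i <= be k i]].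
pose c k j := \prod_(i < n | (j <= i)%N) (be k i - al k i).
have c_ge0 k j : 0 <= c k j by apply: prodr_ge0 => i _; rewrite subr_ge0.
have mslab (a' d' al' be' : R) :
    measurable [set t : R | al' <= a' + t * d' <= be'].
  rewrite (_ : [set _ | _] = (fun t : R => a' + t * d') @^-1` [set` `[al', be']]).
    rewrite -[X in measurable X]setTI.
    apply: (_ : measurable_fun setT (fun t : R => a' + t * d')) => //.
    by apply: measurable_funD => //; exact: measurable_funM.
  by apply/seteqP; split => t /=; rewrite in_itv.
have T_ext k j (u v : 'rV[R]_n) : (forall i : 'I_n, (i < j)%N -> u 0 i = v 0 i) ->
    T k j u = T k j v.
  move=> uv; apply/seteqP; split=> t [Pk t01 h]; split=> // i ij.
    by rewrite -uv//; exact: h.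
  by rewrite uv//; exact: h.
have TS k (j : 'I_n) u : T k j.+1 u =
    T k j u `&` [set t | al k j <= a 0 j + u 0 j + t * d 0 j <= be k j].
  apply/seteqP; split=> [t [Pk t01 h]|t [[Pk t01 h] hj]].
    split; last exact: h.
    by split => // i ij; apply: h; rewrite ltnS ltnW.
  split=> // i; rewrite ltnS leq_eqVlt => /orP[/eqP/val_inj ->//|]; exact: h.
have T0 k u : T k 0%N u = if k \in P then [set` `[0, 1]%R] else set0.
  case: ifPn => [|/negP]; rewrite inE => Pk; apply/seteqP; split=> t.
  - by case=> _ t01 _; rewrite /= in_itv.
  - by rewrite /= in_itv/= => t01; split.
  - by case.
  - by [].
have mT k j u : (j <= n)%N -> measurable (T k j u).
  elim: j => [_|j IHj jn]; first by rewrite T0; case: ifP.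
  rewrite (TS k (Ordinal jn)); apply: measurableI; first by apply: IHj; exact: ltnW.
  by apply: mslab.
have [u [ueta Su]] : exists u : 'rV[R]_n, `|u| <= eta /\
    (\sum_(0 <= k <oo) (c k n)%:E * mu (T k n u) <=
     ((delta * eta ^+ n) / eta ^+ n)%:E)%E.
  suff: forall j, (j <= n)%N -> exists u : 'rV[R]_n, `|u| <= eta /\
      (\sum_(0 <= k <oo) (c k j)%:E * mu (T k j u) <=
       ((delta * eta ^+ n) / eta ^+ j)%:E)%E by exact.
  elim=> [_|j IHj jn].
    exists 0; split; first by rewrite normr0 ltW.
    rewrite expr0 divr1; apply: le_trans (ltW vol).
    rewrite esum_mkcond nneseries_esumT.
      apply: le_esum => k _; rewrite T0.
      case: ifPn => kP; last by rewrite measure0 mule0.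
      rewrite lebesgue_measure_itv/= lte_fin ltr01 oppr0 adde0 mule1 lee_fin.
      by rewrite /c /box_volume /al /be kP; under eq_bigl do rewrite leq0n.
    by move=> k; rewrite mule_ge0// lee_fin.
  have [u [ueta Su]] := IHj (ltnW jn).
  pose i0 := Ordinal jn.
  have [||||s [seta Ss]] := @slab_selection R (fun k => T k j u)
    (fun k => c k j.+1) (al ^~ i0) (be ^~ i0) (a 0 i0) (d 0 i0) eta
    ((delta * eta ^+ n) / eta ^+ j) eta0 _ _ _ (fun k => albe k i0).
  - by rewrite divr_gt0// exprn_gt0.
  - by move=> k; apply: mT; exact: ltnW.
  - by move=> k.
  - apply: le_trans Su; rewrite le_eqVlt; apply/orP; left; apply/eqP.
    apply: eq_eseriesr => k _; congr (_%:E * _)%E.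
    rewrite [RHS](bigD1 i0)//= mulrC; congr (_ * _); apply: eq_bigl => i.
    by rewrite ltn_neqAle andbC eq_sym.
  exists (\row_i (if i == i0 then s else u 0 i)); split.
    apply: rV_norm_le; first exact: ltW.
    by move=> i; rewrite mxE; case: ifP => // _; apply: le_trans ueta; exact: mx_norm_ge.
  rewrite exprSr invfM mulrA; apply: le_trans Ss.
  rewrite le_eqVlt; apply/orP; left; apply/eqP.
  apply: eq_eseriesr => k _; congr (_%:E * mu _)%E.
  rewrite (TS k i0) mxE eqxx; congr (_ `&` _); apply: T_ext => i ij.
  by rewrite mxE; case: eqP => // ii0; move: ij; rewrite ii0 ltnn.
exists u, (\bigcup_k T k n u); split=> //.
- by apply: bigcup_measurable => k _; exact: mT.
- have mU : measurable (\bigcup_k T k n u).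
    by apply: bigcup_measurable => k _; exact: mT.
  apply: (le_trans (measure_sigma_subadditive mu (fun k => mT k n u (leqnn n)) mU
    (@subset_refl _ _))).
  move: Su; rewrite mulfK ?gt_eqF ?exprn_gt0//; apply: le_trans.
  apply: lee_nneseries => // k _; rewrite /c big_pred0 ?mul1e// => i.
  by rewrite leqNgt ltn_ord.
- move=> t t01 /cov[k Pk bk]; exists k => //; split=> // i _.
  have := bk i; rewrite !mxE /al /be mem_set//.
Qed.

End NullSet.

(** * Real functions with small slope off a set of small measure *)

Section Creeping.
Context {R : realType}.
Local Notation mu := (@lebesgue_measure R).

(* Off E the slope of phi is at most eps, on E at most L; E is enlarged to an
   open set G so that near any point one of the two bounds holds, and then
   t |-> eps * t + L * mu (G `&` [0, t]) dominates the variation of phi. *)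
Lemma lipschitz_increment (phi : R -> R) (L eps delta : R) (E : set R) :
  0 <= L -> 0 <= eps -> 0 < delta -> measurable E -> (mu E <= delta%:E)%E ->
  (forall s t : R, 0 <= s <= 1 -> 0 <= t <= 1 -> `|phi s - phi t| <= L * `|s - t|) ->
  (forall t : R, 0 <= t <= 1 -> ~ E t -> exists2 r : R, 0 < r &
    forall s : R, 0 <= s <= 1 -> `|s - t| < r -> `|phi s - phi t| <= eps * `|s - t|) ->
  `|phi 1 - phi 0| <= eps + L * (delta + delta).
Proof.
move=> L0 eps0 delta0 mE muE lip slope.
have [G [oG EG muGE]] : exists G : set R,
    [/\ open G, E `<=` G & (mu (G `\` E) < delta%:E)%E].
  by apply: lebesgue_regularity_outer => //; apply: le_lt_trans muE _; exact: ltry.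
have mG : measurable G by exact: open_measurable.
have muG : (mu G <= (delta + delta)%:E)%E.
  rewrite -(setDUK EG); apply: le_trans (measureU2 _ _ _) _ => //.
    exact: measurableD.
  by rewrite EFinD leeD// ltW.
have le_mu (C D : set R) : measurable C -> measurable D -> C `<=` D ->
    (mu C <= mu D)%E.
  by move=> mC mD CD; apply: (@le_measure _ _ _ mu) => //; rewrite inE.
pose A t : set R := G `&` [set` `[0, t]].
have mA t : measurable (A t) by apply: measurableI.
have muA t : mu (A t) \is a fin_num.
  rewrite ge0_fin_numE//; apply: (@le_lt_trans _ _ (mu G)).
    by apply: le_mu => //; exact: subIsetl.
  exact: le_lt_trans muG (ltry _).
pose V t := fine (mu (A t)).
have V_mono (s t : R) : s <= t -> V s <= V t.
  move=> st; apply: fine_le => //; apply: le_mu => //.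
  apply: setIS => x /=; rewrite !in_itv/= => /andP[-> xs]; exact: (le_trans xs st).
have V_slope : forall s t : R, 0 <= s <= t -> [set` `]s, t]] `<=` G ->
    t - s <= V t - V s.
  move=> s t /andP[s0 st] stG.
  suff : (mu (A s) + (t - s)%:E <= mu (A t))%E.
    by rewrite -(fineK (muA s)) -(fineK (muA t)) -EFinD lee_fin -/(V s) -/(V t); lra.
  have -> : (t - s)%:E = mu [set` `]s, t]].
    rewrite lebesgue_measure_itv/= lte_fin; case: ltP => // ts.
    by rewrite (le_anti (_ : s <= t <= s)) ?subrr// st.
  have sub : A s `|` [set` `]s, t]] `<=` A t.
    move=> x [[Gx]|] /=; rewrite !in_itv/= => /andP[x0 xs]; split => //=.
    - by rewrite in_itv/= x0 (le_trans xs).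
    - by apply: stG; rewrite /= in_itv/= x0.
    - by rewrite in_itv/= xs andbT (le_trans s0)// ltW.
  have dis : A s `&` [set` `]s, t]] = set0.
    rewrite -subset0 => x [[_] /=]; rewrite !in_itv/= => /andP[_ xs] /andP[].
    by rewrite ltNge xs.
  have mst : measurable [set` `]s, t]] by exact: measurable_itv.
  have <- := measureU mu (mA s) mst dis.
  exact: le_mu (measurableU _ _ (mA s) mst) (mA t) sub.
pose B t := eps * t + L * V t.
have B_local : forall t : R, 0 <= t <= 1 -> exists2 r : R, 0 < r & forall s : R, 0 <= s <= 1 ->
    `|s - t| < r -> (s <= t -> `|phi t - phi s| <= B t - B s) /\
                    (t <= s -> `|phi s - phi t| <= B s - B t).
  move=> t t01; have [Gt|nGt] := pselect (G t).
    have /nbhs_ballP[r r0 rG] : nbhs t G by exact: open_nbhs_nbhs.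
    exists r => // s s01 st.
    have inG x : `|x - t| < r -> G x by move=> xt; apply: rG; rewrite /ball/= distrC.
    split=> ts.
    - have Vst : t - s <= V t - V s.
        apply: V_slope; first by case/andP: s01 => ->.
        move=> x /=; rewrite in_itv/= => /andP[sx xt]; apply: inG.
        move: st; rewrite !ltr_norml => /andP[]; lra.
      have := lip t s t01 s01; rewrite (ger0_norm (_ : 0 <= t - s)) ?subr_ge0// /B.
      have := ler_wpM2l L0 Vst; have := ler_wpM2l eps0 ts; lra.
    - have Vst : s - t <= V s - V t.
        apply: V_slope; first by case/andP: t01 => ->.
        move=> x /=; rewrite in_itv/= => /andP[sx xt]; apply: inG.
        move: st; rewrite !ltr_norml => /andP[]; lra.
      have := lip s t s01 t01; rewrite (ger0_norm (_ : 0 <= s - t)) ?subr_ge0// /B.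
      have := ler_wpM2l L0 Vst; have := ler_wpM2l eps0 ts; lra.
  have [r r0 rP] := slope t t01 (fun Et => nGt (EG _ Et)).
  exists r => // s s01 st; have phist := rP s s01 st.
  split=> ts; have := ler_wpM2l L0 (V_mono _ _ ts); rewrite /B.
  - move: phist; rewrite distrC [`|s - t|]distrC.
    by rewrite (ger0_norm (_ : 0 <= t - s)) ?subr_ge0//; lra.
  - by move: phist; rewrite (ger0_norm (_ : 0 <= s - t)) ?subr_ge0//; lra.
(* Continuous induction on [0, 1]: the supremum s of S belongs to S by the left half of [B_local] at
   s, and s < 1 is refuted by its right half. *)
pose S := [set t | 0 <= t <= 1 /\ `|phi t - phi 0| <= B t - B 0].
have S0 : S 0 by split; rewrite ?lexx ?ler01// !subrr normr0.
have supS : has_sup S.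
  by split; [exists 0|exists 1 => t [/andP[]]].
set s := sup S.
have s01 : 0 <= s <= 1.
  rewrite ub_le_sup//=; last by case: supS.
  by apply: ge_sup; [exists 0|move=> t [/andP[]]].
have [r r0 rP] := B_local s s01.
have Ss : S s.
  have [t [t01 St] tr] := sup_adherent r0 supS.
  have ts : t <= s by apply: ub_le_sup => //; case: supS.
  have [|/(_ ts) + _] := rP t t01; first by rewrite ler0_norm ?subr_le0//; move: tr; rewrite -/s; lra.
  split=> //; have := ler_distD (phi t) (phi s) (phi 0); lra.
have s1 : s = 1.
  apply/le_anti; case/andP: s01 => s0 ->; rewrite leNgt; apply/negP => s1.
  have [t [st t1 tr]] : exists t, [/\ s < t, t <= 1 & t <= s + r / 2].
    exists (Num.min 1 (s + r / 2)); split; last 2 first.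
    - by rewrite ge_min lexx.
    - by rewrite ge_min lexx orbT.
    - by rewrite lt_min s1; lra.
  have t01 : 0 <= t <= 1.
    by rewrite t1 andbT (le_trans s0)// ltW.
  have [|_ /(_ (ltW st))] := rP t t01; first by rewrite ger0_norm; lra.
  move=> phits; case: Ss => _ phis.
  suff /(ub_le_sup (proj2 supS)) : S t by rewrite -/s; lra.
  split=> //; have := ler_distD (phi s) (phi t) (phi 0); lra.
move: Ss; rewrite s1 => -[_]; rewrite /B.
have V0 : 0 <= V 0 by exact: fine_ge0.
have V1 : V 1 <= delta + delta.
  rewrite -lee_fin fineK//; apply: le_trans muG.
  by apply: le_mu => //; exact: subIsetl.
have := ler_wpM2l L0 V1; have := mulr_ge0 L0 V0; lra.
Qed.

End Creeping.

(** * Increments along a segment of a function differentiable almost everywhere *)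

Section Increment.
Context {R : realType} {n : nat}.
Implicit Types (f : 'rV[R]_n -> R) (U D : set 'rV[R]_n) (a d p u x : 'rV[R]_n).

Lemma dot_gradient f p h : dot (gradient f p) h = 'd f p h.
Proof.
rewrite {2}(row_sum_delta h) linear_sum; apply: eq_bigr => i _.
by rewrite linearZ mxE mulrC.
Qed.

Lemma gradient_expansion f p : differentiable f p ->
  forall e : R, 0 < e -> exists2 r : R, 0 < r & forall h, `|h| < r ->
    `|f (p + h) - f p - dot (gradient f p) h| <= e * `|h|.
Proof.
move=> /diff_locallyP[_ /eqaddoP fp] e /fp /nbhs_norm0P[r /= r0 rP].
exists r => // h /rP; apply: le_trans.
by rewrite dot_gradient -addrA -opprD [p + h]addrC.
Qed.

(* c0 + c1 * t is the approximate slope at time t. *)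
Lemma increment_bound f U D a d (L c0 c1 eps eta : R) :
  lebesgue_outer (U `\` D) = 0%E ->
  0 <= L -> (forall y z, U y -> U z -> `|f y - f z| <= L * `|y - z|) ->
  (forall y, D y -> differentiable f y) -> 0 < eta -> 0 <= eps ->
  (forall u (t : R), `|u| <= eta -> 0 <= t <= 1 -> U (a + u + t *: d)) ->
  (forall u (t : R), `|u| <= eta -> 0 <= t <= 1 -> D (a + u + t *: d) ->
    `|dot (gradient f (a + u + t *: d)) d - (c0 + c1 * t)| <= eps) ->
  `|f (a + d) - f a - (c0 + c1 / 2)| <= eps.
Proof.
move=> N0 L0 lip dif eta0 eps0 inU slope; apply/ler_addgt0Pr => e e0.
(* K is a Lipschitz constant on [0, 1] for the function [chi] below. With [delta] the exceptional
   times cost at most e / 4, and with [eta1] the translation costs at most e / 8 at each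
   endpoint. *)
pose K := L * `|d| + `|c0| + `|c1|.
have K0 : 0 <= K by rewrite !addr_ge0 ?mulr_ge0.
pose delta := e / (8 * (K + 1)).
have delta0 : 0 < delta by rewrite divr_gt0// mulr_gt0//; lra.
have Kdelta : K * (delta + delta) <= e / 4.
  have dE : delta * (8 * (K + 1)) = e by rewrite /delta divfK// gt_eqF//; lra.
  lra.
pose eta1 := Num.min eta (e / (8 * (L + 1))).
have eta10 : 0 < eta1 by rewrite lt_min eta0 divr_gt0// mulr_gt0//; lra.
have eta1eta : eta1 <= eta by rewrite ge_min lexx.
have Leta : L * eta1 <= e / 8.
  apply: (@le_trans _ _ (L * (e / (8 * (L + 1))))).
    by rewrite ler_wpM2l// ge_min lexx orbT.
  have q0 : 0 < e / (8 * (L + 1)) by rewrite divr_gt0//; lra.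
  have : e / (8 * (L + 1)) * (8 * (L + 1)) = e by rewrite divfK// gt_eqF//; lra.
  lra.
have [u [E [ueta1 mE muE NE]]] := @avoid_null_set R n _ a d _ _ N0 eta10 delta0.
have ueta : `|u| <= eta by exact: le_trans eta1eta.
(* Subtracting the primitive of c0 + c1 * t leaves a function whose slope is at most eps + e / 4
   whenever the translated segment is in D. *)
pose chi (t : R) := f (a + u + t *: d) - (c0 * t + c1 / 2 * t ^+ 2).
have := @lipschitz_increment R chi K (eps + e / 4) delta E K0 _ delta0 mE muE.
have -> : chi 1 = f (a + u + d) - (c0 + c1 / 2).
  by rewrite /chi scale1r expr1n !mulr1.
have -> : chi 0 = f (a + u).
  by rewrite /chi scale0r addr0 expr0n /= !mulr0 addr0 subr0.
have U0 v : `|v| <= eta -> U (a + v).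
  by move=> veta; have := inU v 0 veta; rewrite scale0r addr0 lexx ler01; exact.
have U1 v : `|v| <= eta -> U (a + v + d).
  by move=> veta; have := inU v 1 veta; rewrite scale1r lexx ler01; exact.
have n0 : `|0 : 'rV[R]_n| <= eta by rewrite normr0 ltW.
have lipu : `|f (a + u) - f a| <= e / 8.
  have := lip _ _ (U0 _ ueta) (U0 _ n0); rewrite addr0 addrAC subrr add0r.
  by move/le_trans; apply; apply: le_trans Leta; exact: ler_wpM2l.
have lipud : `|f (a + u + d) - f (a + d)| <= e / 8.
  have := lip _ _ (U1 _ ueta) (U1 _ n0).
  rewrite addr0 (_ : a + u + d - (a + d) = u); last by apply/rowP => i; rewrite !mxE; ring.
  by move/le_trans; apply; apply: le_trans Leta; exact: ler_wpM2l.
move=> incr; have {incr} : `|f (a + u + d) - (c0 + c1 / 2) - f (a + u)| <=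
    eps + e / 4 + K * (delta + delta).
  apply: incr; first lra.
  - move=> s t s01 t01; have := lip _ _ (inU u s ueta s01) (inU u t ueta t01).
    rewrite (_ : a + u + s *: d - _ = (s - t) *: d); last first.
      by apply/rowP => i; rewrite !mxE; ring.
    rewrite normrZ => fst.
    have -> : chi s - chi t = f (a + u + s *: d) - f (a + u + t *: d)
        - (c0 + c1 * ((s + t) / 2)) * (s - t) by rewrite /chi; field.
    apply: le_trans (ler_normB _ _) _; rewrite normrM /K.
    have : `|c0 + c1 * ((s + t) / 2)| <= `|c0| + `|c1|.
      apply: le_trans (ler_normD _ _) _; rewrite lerD2l normrM ler_piMr//.
      by case/andP: s01 => ? ?; case/andP: t01 => ? ?; rewrite ger0_norm; lra.
    move=> /(ler_wpM2r (normr_ge0 (s - t))); move: fst; lra.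
  - move=> t t01 Et; set p := a + u + t *: d.
    have Dp : D p.
      by apply: contrapT => nDp; apply: Et; apply: NE => //; split=> //; exact: inU.
    have e10 : 0 < e / (8 * (`|d| + 1)).
      by rewrite divr_gt0// mulr_gt0// ltr_wpDl.
    have [r r0 rP] := @gradient_expansion f p (dif _ Dp) _ e10.
    have d10 : 0 < `|d| + 1 by rewrite ltr_wpDl.
    have c10 : 0 < `|c1| + 1 by rewrite ltr_wpDl.
    exists (Num.min (r / (`|d| + 1)) (e / (8 * (`|c1| + 1)))).
      by rewrite lt_min !divr_gt0// mulr_gt0.
    move=> s s01; rewrite lt_min => /andP[st1 st2].
    have -> : chi s - chi t =
        (f (p + (s - t) *: d) - f p - dot (gradient f p) ((s - t) *: d)) +
        (s - t) * (dot (gradient f p) d - (c0 + c1 * t)) - c1 / 2 * (s - t) ^+ 2.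
      rewrite dotZr /chi /p -(addrA (a + u)) -scalerDl [t + (s - t)]addrC subrK.
      by field.
    have X : `|f (p + (s - t) *: d) - f p - dot (gradient f p) ((s - t) *: d)| <=
        e / 8 * `|s - t|.
      apply: le_trans (rP _ _) _; rewrite normrZ.
        apply: le_lt_trans (_ : `|s - t| * (`|d| + 1) < r).
          by rewrite ler_wpM2l// lerDl.
        by rewrite -ltr_pdivlMr.
      rewrite mulrCA mulrC ler_wpM2r// mulrAC ler_pdivrMr ?mulr_gt0//.
      by have := mulr_ge0 (ltW e0) (normr_ge0 d); lra.
    have Y := slope u t ueta t01 Dp.
    have Z : `|c1 / 2 * (s - t) ^+ 2| <= e / 8 * `|s - t|.
      rewrite normrM [`|(s - t) ^+ 2|]normrX expr2 mulrA ler_wpM2r//.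
      rewrite normrM (ger0_norm (_ : 0 <= 2^-1)) ?invr_ge0//.
      move/ltW: st2; rewrite ler_pdivlMr ?mulr_gt0//.
      have := normr_ge0 (s - t); have := normr_ge0 c1.
      move=> ? ? ?; have : 0 <= `|c1| * `|s - t| by rewrite mulr_ge0.
      lra.
    apply: le_trans (ler_normB _ _) _; apply: le_trans (lerD (ler_normD _ _) Z) _.
    rewrite normrM; have := ler_wpM2l (normr_ge0 (s - t)) Y; move: X.
    have : 0 <= e * `|s - t| by rewrite mulr_ge0// ltW.
    lra.
move: lipu lipud; rewrite !ler_norml => /andP[? ?] /andP[? ?] /andP[? ?].
apply/andP; split; lra.
Qed.
End Increment.

(** * Expansions at points of extended twice differentiability *)

Section ScalarExpansion.
Context {R : realType} {n : nat}.
Implicit Types (f : 'rV[R]_n -> R) (U D : set 'rV[R]_n) (A : 'M[R]_n).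
Implicit Types (a d p u x y z : 'rV[R]_n).

(** The definition in epsilon form and in the sup norm; the Lipschitz constant and the tolerance
    absorb the factor n. The point y = x, excluded from the limit, is included because both sides
    vanish there. *)
Lemma ext_hessian_gradient f x A : is_ext_hessian f x A ->
  exists (L r0 : R) U D, [/\ 0 <= L, 0 < r0,
    forall y, `|y - x| < r0 -> U y,
    forall y z, U y -> U z -> `|f y - f z| <= L * `|y - z| &
    lebesgue_outer (U `\` D) = 0%E /\
    (forall y, D y -> differentiable f y) /\
    forall e : R, 0 < e -> exists2 r : R, 0 < r & forall y, D y -> `|y - x| < r ->
      `|gradient f y - gradient f x - (y - x) *m A^T| <= e * `|y - x|].
Proof.
case=> fx [U [D [/nbhs_ballP[r0 /= r00 r0U] [DU [N0 [[L [L0 lip]] [dif cvg]]]]]]].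
exists (L * n%:R), r0, U, D; split=> //.
- by rewrite mulr_ge0.
- by move=> y yx; apply: r0U; rewrite -ball_normE/= distrC.
- move=> y z Uy Uz; apply: le_trans (lip _ _ Uy Uz) _.
  by rewrite -mulrA ler_wpM2l// enorm_le_norm.
split=> //; split=> // e e0.
have e10 : 0 < e / (n%:R + 1) by rewrite divr_gt0// ltr_wpDl.
move/cvgr0Pnorm_lt: cvg => /(_ _ e10).
rewrite near_withinE => /nbhs_ballP[r /= r0' rP].
exists r => // y Dy yr.
have [->|yx] := eqVneq y x; first by rewrite !subrr mul0mx subrr normr0 mulr0.
have := rP y; rewrite -ball_normE/= distrC => /(_ yr yx Dy).
have yx0 : 0 < enorm (y - x) by rewrite enorm_gt0// subr_eq0.
rewrite normrZ normfV (gtr0_norm yx0) mulrC ltr_pdivrMr// => /ltW/le_trans; apply.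
rewrite -mulrA ler_wpM2l ?(ltW e0)// ler_pdivrMl ?ltr_wpDl//.
by apply: le_trans (enorm_le_norm _) _; rewrite ler_wpM2r// lerDl.
Qed.

Lemma segment_norm a d x (r t : R) : `|a - x| < r -> `|a + d - x| < r ->
  0 <= t <= 1 -> `|a + t *: d - x| < r.
Proof.
move=> ar dr /andP[t0 t1].
have -> : a + t *: d - x = (1 - t) *: (a - x) + t *: (a + d - x).
  by apply/rowP => i; rewrite !mxE; ring.
apply: le_lt_trans (ler_normD _ _) _; rewrite !normrZ !ger0_norm ?subr_ge0//.
have [->|tn0] := eqVneq t 0; first by rewrite subr0 mul1r mul0r addr0.
have t00 : 0 < t by rewrite lt_neqAle eq_sym tn0.
have : t * `|a + d - x| < t * r by rewrite ltr_pM2l.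
have : (1 - t) * `|a - x| <= (1 - t) * r by rewrite ler_wpM2l ?subr_ge0// ltW.
lra.
Qed.

(** All translates by at most r of the segment stay within 2 * r of x, and on D the gradient there
    differs from that at x by at most (1 + n |A^T|) * 2 * r. So [increment_bound] applies with the
    constant slope c0 and c1 = 0. *)
Lemma ext_hessian_strict f x A : is_ext_hessian f x A ->
  forall e : R, 0 < e -> exists2 r : R, 0 < r & forall a d,
    `|a - x| < r -> `|a + d - x| < r ->
    `|f (a + d) - f a - dot (gradient f x) d| <= e * `|d|.
Proof.
move=> /ext_hessian_gradient[L [r0 [U [D [L0 r00 r0U lip [N0 [dif grad]]]]]]] e e0.
have [r1 r10 r1P] := grad 1 ltr01.
pose C := (n%:R + 1) * (1 + n%:R * `|A^T|) : R.
have A0 : 0 < 1 + n%:R * `|A^T| by rewrite ltr_pwDl// mulr_ge0.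
have C0 : 0 < C by rewrite mulr_gt0// ltr_wpDl.
pose r := Num.min (Num.min (r0 / 2) (r1 / 2)) (e / (2 * C)).
have r0' : 0 < r by rewrite !lt_min !divr_gt0// mulr_gt0.
have rr0 : r <= r0 / 2 by rewrite !ge_min lexx.
have rr1 : r <= r1 / 2 by rewrite !ge_min lexx !orbT.
have rC : C * (2 * r) <= e.
  have : r <= e / (2 * C) by rewrite ge_min lexx orbT.
  by rewrite ler_pdivlMr ?mulr_gt0//; lra.
exists r => // a d ar dr.
have seg u (t : R) : `|u| <= r -> 0 <= t <= 1 -> `|a + u + t *: d - x| < 2 * r.
  move=> ur t01; rewrite (_ : a + u + t *: d - x = u + (a + t *: d - x)); last first.
    by apply/rowP => i; rewrite !mxE; ring.
  apply: le_lt_trans (ler_normD _ _) _.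
  by have := segment_norm _ _ _ _ _ ar dr t01; lra.
have <- : dot (gradient f x) d + 0 / 2 = dot (gradient f x) d.
  by rewrite mul0r addr0.
apply: (@increment_bound R n f U D a d L (dot (gradient f x) d) 0 (e * `|d|) r
  N0 L0 lip dif r0').
- by rewrite mulr_ge0// ltW.
- by move=> u t ur t01; apply: r0U; apply: lt_le_trans (seg u t ur t01) _; lra.
move=> u t ur t01 Dp; 
have slopeE q : dot q d - (dot (gradient f x) d + 0 * t) = dot (q - gradient f x) d.
  by rewrite dotBl (mul0r t) addr0.
rewrite slopeE.
have pr := seg u t ur t01; set p := a + u + t *: d in Dp pr *.
apply: le_trans (dot_norm _ _) _; rewrite ler_wpM2r//.
have pr1 : `|p - x| < r1 by lra.
have := r1P p Dp pr1; rewrite mul1r => G1.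
have : `|gradient f p - gradient f x| <= (1 + n%:R * `|A^T|) * (2 * r).
  rewrite -(subrK ((p - x) *m A^T) (gradient f p - gradient f x)).
  apply: le_trans (ler_normD _ _) _.
  have := @mulmx_norm R n n (p - x) A^T.
  have : (1 + n%:R * `|A^T|) * `|p - x| <= (1 + n%:R * `|A^T|) * (2 * r).
    by rewrite ler_wpM2l ?ltW.
  lra.
move=> /(ler_wpM2l (ler0n R n)) /le_trans; apply; apply: le_trans rC.
rewrite /C -mulrA ler_wpM2r ?lerDl//.
by rewrite mulr_ge0 ?(ltW A0)// mulr_ge0// ltW.
Qed.

(* Along the ray from x only the quadratic form of A enters, so its symmetry
   is irrelevant. *)
Lemma ext_hessian_taylor f x A : is_ext_hessian f x A ->
  forall e : R, 0 < e -> exists2 r : R, 0 < r & forall d, `|d| < r ->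
    `|f (x + d) - f x - dot (gradient f x) d - 2^-1 * dot (d *m A^T) d|
      <= e * `|d| ^+ 2.
Proof.
move=> /ext_hessian_gradient[L [r0 [U [D [L0 r00 r0U lip [N0 [dif grad]]]]]]] e e0.
have e10 : 0 < e / (4 * (n%:R + 1)) by rewrite divr_gt0// mulr_gt0// ltr_wpDl.
have e1E : e / (4 * (n%:R + 1)) * (4 * (n%:R + 1)) = e.
  by rewrite divfK// gt_eqF// mulr_gt0// ltr_wpDl.
have [r1 r10 r1P] := grad _ e10; set e1 := e / (4 * _) in e10 e1E r1P.
pose r := Num.min (r0 / 2) (r1 / 2).
have r0' : 0 < r by rewrite !lt_min !divr_gt0.
have rr0 : r <= r0 / 2 by rewrite !ge_min lexx.
have rr1 : r <= r1 / 2 by rewrite !ge_min lexx !orbT.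
exists r => // d dr.
have [->|d0] := eqVneq d 0.
  by rewrite addr0 subrr !(dot0r, sub0r, mul0mx) oppr0 mulr0 subrr !normr0 expr0n mulr0.
have {}d0 : 0 < `|d| by rewrite normr_gt0.
pose B := n%:R * (n%:R * `|A^T|) : R.
have B0 : 0 <= B by rewrite !mulr_ge0.
(* A translation by u changes the slope along d by the product of u *m A^T with d. This has to be at
   most e / 2 * |d|^2, so eta must shrink in proportion to |d|. *)
have [eta [eta0 etad etaB]] : exists eta : R,
    [/\ 0 < eta, eta <= `|d| & B * eta <= e / 2 * `|d|].
  exists (Num.min `|d| (e / 2 * `|d| / (B + 1))); split.
  - by rewrite lt_min d0 !divr_gt0 ?mulr_gt0// ?ltr_wpDl// divr_gt0.
  - by rewrite ge_min lexx.
  - apply: (@le_trans _ _ (B * (e / 2 * `|d| / (B + 1)))).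
      by rewrite ler_wpM2l// ge_min lexx orbT.
    have q0 : 0 < e / 2 * `|d| / (B + 1).
      by rewrite !divr_gt0 ?mulr_gt0// ?ltr_wpDl// divr_gt0.
    have : e / 2 * `|d| / (B + 1) * (B + 1) = e / 2 * `|d|.
      by rewrite divfK// gt_eqF// ltr_wpDl.
    lra.
have seg u (t : R) : `|u| <= eta -> 0 <= t <= 1 ->
    `|x + u + t *: d - x| <= 2 * `|d|.
  move=> ueta /andP[t0 t1].
  rewrite (_ : x + u + t *: d - x = u + t *: d); last by apply/rowP => i; rewrite !mxE; ring.
  apply: le_trans (ler_normD _ _) _; rewrite normrZ ger0_norm//.
  have : t * `|d| <= 1 * `|d| by rewrite ler_wpM2r.
  lra.
(* The slope at time t is c0 + c1 * t with c1 the quadratic form at d; its mean c0 + c1 / 2 over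
   [0, 1] is the source of the factor 1/2. *)
rewrite -(addrA (_ - _)) -opprD [2^-1 * _]mulrC.
apply: (@increment_bound R n f U D x d L (dot (gradient f x) d)
  (dot (d *m A^T) d) (e * `|d| ^+ 2) eta N0 L0 lip dif eta0).
- by rewrite mulr_ge0// ?sqr_ge0// ltW.
- move=> u t ueta t01; apply: r0U; apply: le_lt_trans (seg u t ueta t01) _; lra.
move=> u t ueta t01 Dp.
have pr := seg u t ueta t01; set p := x + u + t *: d in Dp pr *.
have pr1 : `|p - x| < r1 by lra.
have Gp := r1P p Dp pr1; set G := (X in `|X| <= _) in Gp.
have -> : dot (gradient f p) d - (dot (gradient f x) d + dot (d *m A^T) d * t) =
    dot G d + dot (u *m A^T) d.
  rewrite /G !dotBl (_ : p - x = u + t *: d); last first.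
    by apply/rowP => i; rewrite !mxE; ring.
  have alg (q1 q2 q3 q4 : R) : q1 - (q2 + q3 * t) = q1 - q2 - (q4 + t * q3) + q4.
    by ring.
  rewrite mulmxDl dotDl -(scalemxAl t d) (dotZl t (d *m A^T)).
  exact: alg.
apply: le_trans (ler_normD _ _) _.
have GG : `|dot G d| <= e / 2 * `|d| ^+ 2.
  apply: le_trans (dot_norm _ _) _; rewrite expr2 mulrA ler_wpM2r//.
  have : `|G| <= e1 * (2 * `|d|).
    by apply: le_trans Gp _; rewrite ler_wpM2l// ltW.
  move=> /(ler_wpM2l (ler0n R n)).
  have := mulr_ge0 (ltW e10) (normr_ge0 d); nra.
have UU : `|dot (u *m A^T) d| <= e / 2 * `|d| ^+ 2.
  apply: le_trans (dot_norm _ _) _; rewrite expr2 mulrA ler_wpM2r//.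
  apply: le_trans etaB; rewrite /B -mulrA ler_wpM2l//.
  by apply: le_trans (@mulmx_norm R n n _ _) _; rewrite ler_wpM2l// mulr_ge0.
lra.
Qed.
End ScalarExpansion.

Section MapExpansion.
Context {R : realType} {n m : nat}.
Implicit Types (F : 'rV[R]_n -> 'rV[R]_m) (a d w x : 'rV[R]_n).

Lemma uniform_radius (P : 'I_m -> R -> Prop) :
  (forall i, exists2 r : R, 0 < r & P i r) ->
  (forall i (r s : R), s <= r -> P i r -> P i s) ->
  exists2 r : R, 0 < r & forall i, P i r.
Proof.
move=> Pex Pmono.
have /choice[rr rrP] : forall i, exists r : R, 0 < r /\ P i r.
  by move=> i; have [r r0 Pr] := Pex i; exists r.
(* The default value 1 keeps the minimum positive when m = 0. *)
exists (\big[Num.min/1]_i rr i).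
  by apply: lt_bigmin => // i _; case: (rrP i).
move=> i; apply: (Pmono i (rr i)); last by case: (rrP i).
exact: bigmin_le.
Qed.

Lemma differentiable_map F x :
  (forall i, differentiable (fun y => F y 0 i) x) -> differentiable F x.
Proof.
move=> dF.
have -> : F = \sum_(i < m) (fun y => F y 0 i *: delta_mx 0 i).
  by apply/funext => y; rewrite fct_sumE; exact: row_sum_delta.
by apply: differentiable_sum => i; exact: differentiableZl.
Qed.

Lemma jacobian_coord F x w i : differentiable F x ->
  (w *m 'J F x) 0 i = dot (gradient (fun y => F y 0 i) x) w.
Proof.
move=> dF; rewrite dot_gradient /jacobian mul_rV_lin1.
have @c : {linear 'rV[R]_m -> R}.
  by exists (fun M : 'rV[R]_m => M 0 i); do 2![eexists]; do ?[constructor];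
    rewrite ?mxE// => ? *; rewrite ?mxE//; move=> ?; rewrite !mxE.
have cc : continuous c by exact: coord_continuous.
have -> : (fun y => F y 0 i) = c \o F by [].
by rewrite (diff_comp dF (linear_differentiable (F x) cc)) diff_lin.
Qed.

Lemma map_strict F x : ext_twice_differentiable_map F x ->
  forall e : R, 0 < e -> exists2 r : R, 0 < r & forall a d,
    `|a - x| < r -> `|a + d - x| < r ->
    `|F (a + d) - F a - d *m 'J F x| <= e * `|d|.
Proof.
move=> F2 e e0.
have dF : differentiable F x by apply: differentiable_map => i; case: (F2 i) => A [].
have [||r r0 rP] := uniform_radius (fun i r => forall a d, `|a - x| < r ->
    `|a + d - x| < r ->
    `|F (a + d) 0 i - F a 0 i - dot (gradient (fun y => F y 0 i) x) d| <= e * `|d|).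
- by move=> i; have [A hA] := F2 i; exact: (@ext_hessian_strict _ _ _ _ _ hA).
- move=> i r s sr rP a d ar dr; apply: rP; exact: lt_le_trans sr.
exists r => // a d ar dr; apply: rV_norm_le => [|i]; first by rewrite mulr_ge0// ltW.
have := rP i a d ar dr; rewrite -(@jacobian_coord _ _ _ _ dF).
by rewrite !mxE.
Qed.

Lemma map_taylor F x : ext_twice_differentiable_map F x ->
  forall e : R, 0 < e -> exists2 r : R, 0 < r & forall d, `|d| < r ->
    `|F (x + d) - F x - d *m 'J F x - 2^-1 *: ext_hessian_map F x d d|
      <= e * `|d| ^+ 2.
Proof.
move=> F2 e e0.
have dF : differentiable F x by apply: differentiable_map => i; case: (F2 i) => A [].
have [||r r0 rP] := uniform_radius (fun i r => forall d, `|d| < r ->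
    `|F (x + d) 0 i - F x 0 i - dot (gradient (fun y => F y 0 i) x) d
      - 2^-1 * dot (d *m (ext_hessian (fun y => F y 0 i) x)^T) d| <= e * `|d| ^+ 2).
- move=> i; apply: ext_hessian_taylor => //.
  exact: (xgetPex 0 (F2 i)).
- move=> i r s sr rP d dr; apply: rP; exact: lt_le_trans sr.
exists r => // d dr; apply: rV_norm_le => [|i].
  by rewrite mulr_ge0// ?sqr_ge0// ltW.
have := rP i d dr; rewrite -(@jacobian_coord _ _ _ _ dF).
by rewrite !mxE.
Qed.
End MapExpansion.

(** * Finite convex functions *)

Section HahnBanach.
Context {R : realType}.

Definition convex_fun {V : lmodType R} (p : V -> R) := forall x y (t : R),
  0 <= t <= 1 -> p (t *: x + (1 - t) *: y) <= t * p x + (1 - t) * p y.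

(** The Hahn-Banach step that adds one dimension: every left slope - q y (- b) / b lies below every
    right slope q x a / a, whatever the base points x and y, and s is the supremum of the left
    slopes. *)
Lemma one_dim_extension (V : lmodType R) (q : V -> R -> R) :
  (forall x y (a b t : R), 0 <= t <= 1 ->
    q (t *: x + (1 - t) *: y) (t * a + (1 - t) * b) <= t * q x a + (1 - t) * q y b) ->
  (forall x, 0 <= q x 0) -> exists s : R, forall x a, s * a <= q x a.
Proof.
move=> qconv q0.
have key x y (a b : R) : 0 < a -> 0 < b -> - q y (- b) / b <= q x a / a.
  move=> a0 b0; rewrite ler_pdivrMr// mulrAC ler_pdivlMr//.
  have ab : 0 < a + b by rewrite addr_gt0.
  (* With these weights a and - b average to 0, where q is nonnegative. *)
  have t01 : 0 <= b / (a + b) <= 1.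
    by rewrite divr_ge0 ?(ltW b0) ?(ltW ab)//= ler_pdivrMr// mul1r lerDr ltW.
  have tE : 1 - b / (a + b) = a / (a + b).
    by field; rewrite gt_eqF.
  have := qconv x y a (- b) _ t01; rewrite tE.
  rewrite (_ : b / (a + b) * a + _ = 0); last by field; rewrite gt_eqF.
  move=> /(le_trans (q0 _)).
  rewrite mulrAC [a / _ * _]mulrAC -mulrDl pmulr_lge0 ?invr_gt0//.
  lra.
pose S := [set - q y.1 (- y.2) / y.2 | y in [set y : V * R | 0 < y.2]].
have Sub x a : 0 < a -> ubound S (q x a / a).
  by move=> a0 _ [[y b] /= b0 <-]; exact: key.
have S0 : S !=set0 by exists (- q 0 (- 1) / 1), (0, 1) => //=.
exists (sup S) => x a; case: (ltgtP a 0) => [a0|a0|->]; last by rewrite mulr0.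
- have : - q x (- - a) / (- a) <= sup S.
    by apply: ub_le_sup; [exists (q 0 1 / 1); exact: Sub|exists (x, - a) => //=; rewrite oppr_gt0].
  by rewrite opprK ler_pdivrMr ?oppr_gt0// mulrN lerN2.
- rewrite -ler_pdivlMr//; apply: ge_sup => //; exact: Sub.
Qed.

Lemma dot_delta m (i : 'I_m) (u : 'rV[R]_m) : dot (delta_mx 0 i) u = u 0 i.
Proof.
rewrite /dot (bigD1 i)//= big1 ?addr0 => [|j ji]; first by rewrite mxE !eqxx mul1r.
by rewrite mxE eqxx (negPf ji) mul0r.
Qed.

Lemma dot_mulmx n m (s : 'rV[R]_m) (h : 'rV[R]_n) (B : 'M[R]_(n, m)) :
  dot s (h *m B) = dot (s *m B^T) h.
Proof. by rewrite !dotE trmx_mul mulmxA. Qed.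

(* s is built one coordinate at a time; mask j projects on the first j ones. *)
Lemma linear_minorant_extension n m (p : 'rV[R]_m -> R) (B : 'M[R]_(n, m)) v :
  convex_fun p -> (forall h, dot v h <= p (h *m B)) ->
  exists s, forall h u, dot v h + dot s u <= p (h *m B + u).
Proof.
move=> pconv pv.
pose mask j (u : 'rV[R]_m) : 'rV[R]_m := \row_(i < m) (if (i < j)%N then u 0 i else 0).
suff : forall j, (j <= m)%N -> exists s, forall h u,
    dot v h + dot s (mask j u) <= p (h *m B + mask j u).
  move=> /(_ m (leqnn m))[s sP]; exists s => h u; have := sP h u.
  by rewrite (_ : mask m u = u)//; apply/rowP => i; rewrite mxE ltn_ord.
elim=> [_|j IHj jm].
  exists 0 => h u; rewrite (_ : mask 0%N u = 0); last by apply/rowP => i; rewrite !mxE.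
  by rewrite dot0r !addr0.
have [s sP] := IHj (ltnW jm); pose i0 := Ordinal jm.
(* The gap between p and the minorant built so far, with a as the new coordinate; the induction
   hypothesis makes it nonnegative at a = 0. *)
pose q (x : 'rV[R]_n * 'rV[R]_m) (a : R) :=
  p (x.1 *m B + mask j x.2 + a *: delta_mx 0 i0) - (dot v x.1 + dot s (mask j x.2)).
have maskD (t t' : R) u u' : mask j (t *: u + t' *: u') = t *: mask j u + t' *: mask j u'.
  by apply/rowP => i; rewrite !mxE; case: ifP => _ //; rewrite !mulr0 addr0.
have [||s0 s0P] := @one_dim_extension _ q.
- move=> [h u] [h' u'] a b t t01; rewrite /q /=.
  have := pconv (h *m B + mask j u + a *: delta_mx 0 i0)
                (h' *m B + mask j u' + b *: delta_mx 0 i0) t t01.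
  rewrite maskD mulmxDl -!scalemxAl !dotDr !dotZr.
  rewrite (_ : t *: (h *m B) + (1 - t) *: (h' *m B) + _ + _ =
    t *: (h *m B + mask j u + a *: delta_mx 0 i0) +
    (1 - t) *: (h' *m B + mask j u' + b *: delta_mx 0 i0)); last first.
    move: (h *m B) (h' *m B) (mask j u) (mask j u') => X X' Y Y'.
    by apply/rowP => i; rewrite !mxE; ring.
  set P1 := p _; set P2 := p _; set P3 := p _.
  move: (dot v h) (dot v h') (dot s _) (dot s _) => d1 d2 d3 d4; lra.
- by move=> [h u]; rewrite /q /= scale0r addr0 subr_ge0.
(* Coordinate i0 of s is reset to s0; this does not affect the inequality for [mask j u], whose
   coordinate i0 is 0. *)
exists (s + (s0 - s 0 i0) *: delta_mx 0 i0) => h u.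
have -> : mask j.+1 u = mask j u + u 0 i0 *: delta_mx 0 i0.
  apply/rowP => i; rewrite !mxE eqxx ltnS leq_eqVlt /=.
  have [->|ii0] := eqVneq i i0; first by rewrite /= eqxx ltnn mulr1 add0r.
  by rewrite (_ : val i == j = false) ?mulr0 ?addr0//; exact: (negPf ii0).
have := s0P (h, u) (u 0 i0); rewrite /q /= addrA.
rewrite !dotDl !dotDr !dotZl !dotZr !dot_delta (dotC s (delta_mx _ _)) dot_delta.
rewrite !mxE ltnn !eqxx /=.
set P1 := p _; move: (dot v h) (dot s _) => d1 d2; lra.
Qed.

(** At u = - (h *m B) the extended inequality reads (v - s *m B^T) . h <= 0 for every h, which
    forces equality of the two vectors; at h = 0 it says that s is a subgradient of p at y0. *)
Lemma subgradient_chain n m (p : 'rV[R]_m -> R) (B : 'M[R]_(n, m)) y0 v :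
  convex_fun p -> (forall h, p y0 + dot v h <= p (y0 + h *m B)) ->
  exists s, v = s *m B^T /\ forall u, p y0 + dot s u <= p (y0 + u).
Proof.
move=> pconv pv.
have [||s sP] := @linear_minorant_extension n m (fun u => p (y0 + u) - p y0) B v.
- move=> x y t t01; have := pconv (y0 + x) (y0 + y) t t01.
  rewrite (_ : t *: (y0 + x) + _ = y0 + (t *: x + (1 - t) *: y)).
    by set P1 := p _; set P2 := p _; set P3 := p _; lra.
  by apply/rowP => i; rewrite !mxE; ring.
- by move=> h; rewrite lerBrDl.
exists s; split; last first.
  by move=> u; have := sP 0 u; rewrite dot0r mul0mx !add0r lerBrDl.
have vs h : dot (v - s *m B^T) h <= 0.
  by have := sP h (- (h *m B)); rewrite subrr addr0 subrr dotNr dot_mulmx -dotBl.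
apply/eqP; rewrite -subr_eq0; apply/negPn/negP => /enorm_gt0.
by rewrite /enorm (ler0_sqrtr (vs _)) ltxx.
Qed.

End HahnBanach.

(** * Lipschitz regularization of a convex function *)

Section LipschitzRegularization.
Context {R : realType} {m : nat}.
Variables (C : set 'rV[R]_m) (gr : 'rV[R]_m -> R) (l M : R) (y0 : 'rV[R]_m).
Hypotheses (Cy0 : C y0) (l0 : 0 <= l) (lM : l <= M).
Hypothesis gr_lip : forall y z, C y -> C z -> `|gr y - gr z| <= l * `|y - z|.
Hypothesis C_convex : forall y z (t : R), C y -> C z -> 0 <= t <= 1 ->
  C (t *: y + (1 - t) *: z).
Hypothesis gr_convex : forall y z (t : R), C y -> C z -> 0 <= t <= 1 ->
  gr (t *: y + (1 - t) *: z) <= t * gr y + (1 - t) * gr z.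
Implicit Types y z : 'rV[R]_m.

(** The Pasch-Hausdorff envelope: the infimal convolution of gr, set to +oo outside C, with M times
    the sup norm. It agrees with gr on C because M is at least the Lipschitz constant of gr
    there. *)
Definition lipschitz_regularization y : R :=
  inf [set gr z + M * `|y - z| | z in C].
Local Notation Phi := lipschitz_regularization.

Let M0 : 0 <= M. Proof. exact: le_trans lM. Qed.

Lemma lipschitz_regularization_minorant y z : C z ->
  gr y0 - l * `|y - y0| <= gr z + M * `|y - z|.
Proof.
move=> Cz; have := gr_lip y0 z Cy0 Cz; rewrite ler_norml => /andP[_].
have := ler_distD y y0 z; rewrite (distrC y0 y) => /(ler_wpM2l l0).
have := ler_wpM2r (normr_ge0 (y - z)) lM; lra.
Qed.

Lemma has_inf_regularization y : has_inf [set gr z + M * `|y - z| | z in C].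
Proof.
split; first by exists (gr y0 + M * `|y - y0|), y0.
exists (gr y0 - l * `|y - y0|) => _ [z Cz <-].
exact: lipschitz_regularization_minorant.
Qed.

Lemma lipschitz_regularization_le y z : C z -> Phi y <= gr z + M * `|y - z|.
Proof.
by move=> Cz; apply: ge_inf; [case: (has_inf_regularization y)|exists z].
Qed.

Lemma lipschitz_regularization_ge y (c : R) :
  (forall z, C z -> c <= gr z + M * `|y - z|) -> c <= Phi y.
Proof.
move=> cP; apply: lb_le_inf; first by case: (has_inf_regularization y).
by move=> _ [z Cz <-]; exact: cP.
Qed.

Lemma lipschitz_regularization_id y : C y -> Phi y = gr y.
Proof.
move=> Cy; apply/le_anti/andP; split.
  by have := lipschitz_regularization_le y y Cy; rewrite subrr normr0 mulr0 addr0.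
apply: lipschitz_regularization_ge => z Cz.
have := gr_lip y z Cy Cz; rewrite ler_norml => /andP[_].
have := ler_wpM2r (normr_ge0 (y - z)) lM; lra.
Qed.

Lemma lipschitz_regularization_lip y y' : Phi y <= Phi y' + M * `|y - y'|.
Proof.
rewrite -lerBlDr; apply: lipschitz_regularization_ge => z Cz.
have := lipschitz_regularization_le y z Cz.
have := ler_wpM2l M0 (ler_distD y' y z); lra.
Qed.

Lemma lipschitz_regularization_convex : convex_fun Phi.
Proof.
move=> y y' t t01; apply/ler_addgt0Pr => e e0.
have [_ [z Cz <-] ze] := inf_adherent e0 (has_inf_regularization y).
have [_ [z' Cz' <-] ze'] := inf_adherent e0 (has_inf_regularization y').
have := lipschitz_regularization_le (t *: y + (1 - t) *: y') _ (C_convex z z' t Cz Cz' t01).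
have := gr_convex z z' t Cz Cz' t01.
case/andP: (t01) => t0 t1; rewrite -subr_ge0 in t1.
have dist : `|t *: y + (1 - t) *: y' - (t *: z + (1 - t) *: z')| <=
    t * `|y - z| + (1 - t) * `|y' - z'|.
  rewrite (_ : _ - _ = t *: (y - z) + (1 - t) *: (y' - z')); last first.
    by apply/rowP => i; rewrite !mxE; ring.
  by apply: le_trans (ler_normD _ _) _; rewrite !normrZ !ger0_norm.
have := ler_wpM2l M0 dist.
have := ler_wpM2l t0 (ltW ze); have := ler_wpM2l t1 (ltW ze').
rewrite -/(Phi y) -/(Phi y'); lra.
Qed.

End LipschitzRegularization.

Section LimitSubgradient.
Context {R : realType} {n m : nat}.

(* Convexity turns the local inequality at h -> 0 into one for every h, whose
   error e * |h| survives the passage to the limit x' -> x. *)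
Lemma limit_subgradient (F : 'rV[R]_n -> 'rV[R]_m) (J : 'M[R]_(n, m))
    (Phi : 'rV[R]_m -> R) (M : R) (x v : 'rV[R]_n) :
  (forall e : R, 0 < e -> exists2 r : R, 0 < r & forall a d,
    `|a - x| < r -> `|a + d - x| < r -> `|F (a + d) - F a - d *m J| <= e * `|d|) ->
  convex_fun Phi -> 0 <= M -> (forall y z, Phi y <= Phi z + M * `|y - z|) ->
  (forall e : R, 0 < e -> exists x' v', [/\ `|x' - x| < e, `|v' - v| < e &
    exists2 r : R, 0 < r & forall h, `|h| < r ->
      Phi (F x') + dot v' h - e * `|h| <= Phi (F (x' + h))]) ->
  forall h, Phi (F x) + dot v h <= Phi (F x + h *m J).
Proof.
move=> strict conv M0 lip sub h; apply/ler_addgt0Pr => e0 e00.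
(* The sum of all coefficients of e: (1 + M) * |h| from [key], n * |h| from replacing v' by v, and M
   * (1 + n |J|) for each of the two replacements of F x' by F x. The final 1 makes K positive. *)
pose K : R := (1 + M + n%:R) * `|h| + 2 * M * (1 + n%:R * `|J|) + 1.
have K0 : 0 < K.
  by rewrite ltr_wpDl// addr_ge0// !mulr_ge0// !addr_ge0// mulr_ge0.
pose e := Num.min 1 (e0 / K).
have e0' : 0 < e by rewrite lt_min ltr01 divr_gt0.
have eK : e * K <= e0 by rewrite -ler_pdivlMr// ge_min lexx orbT.
have e1 : e <= 1 by rewrite ge_min lexx.
have [r r0 rP] := strict e e0'.
pose e' := Num.min e (r / 2).
have e'0 : 0 < e' by rewrite lt_min e0' divr_gt0.
have e'e : e' <= e by rewrite ge_min lexx.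
have e'r : e' <= r / 2 by rewrite ge_min lexx orbT.
have [x' [v' [x'x v'v [r' r'0 r'P]]]] := sub e' e'0.
pose q := Num.min r' (r / 2).
have q0 : 0 < q by rewrite lt_min r'0 divr_gt0.
have qr' : q <= r' by rewrite ge_min lexx.
have qr : q <= r / 2 by rewrite ge_min lexx orbT.
have h1 : 0 < `|h| + 1 by rewrite ltr_wpDl.
pose s := Num.min 1 (q / (`|h| + 1)).
have s0 : 0 < s by rewrite lt_min ltr01 divr_gt0.
have s1 : s <= 1 by rewrite ge_min lexx.
have sh : `|s *: h| < q.
  have : s * (`|h| + 1) <= q by rewrite -ler_pdivlMr// ge_min lexx orbT.
  by rewrite normrZ gtr0_norm//; lra.
have x'r : `|x' - x| < r by lra.
have x'hr : `|x' + s *: h - x| < r.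
  by rewrite addrAC; apply: le_lt_trans (ler_normD _ _) _; lra.
have str1 := rP x' (s *: h) x'r x'hr.
have str2 : `|F x - F x'| <= (1 + n%:R * `|J|) * e.
  have xE : x' + (x - x') = x by rewrite addrC subrK.
  have xr : `|x' + (x - x') - x| < r by rewrite xE subrr normr0.
  have := rP x' (x - x') x'r xr; rewrite xE.
  have := @mulmx_norm R n m (x - x') J; rewrite (distrC x x') => mn str.
  rewrite -(subrK ((x - x') *m J) (F x - F x')); apply: le_trans (ler_normD _ _) _.
  have : (1 + n%:R * `|J|) * `|x' - x| <= (1 + n%:R * `|J|) * e.
    by rewrite ler_wpM2l ?addr_ge0 ?mulr_ge0//; lra.
  have := ler_wpM2r (normr_ge0 (x' - x)) e1; lra.
have key : Phi (F x') + dot v' h - (1 + M) * e * `|h| <= Phi (F x' + h *m J).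
  have := r'P (s *: h) (lt_le_trans sh qr'); rewrite dotZr normrZ (gtr0_norm s0) => sub1.
  have := lip (F (x' + s *: h)) (F x' + s *: (h *m J)).
  rewrite opprD addrA scalemxAl => lip1.
  have := conv (F x' + h *m J) (F x') s; rewrite s1 (ltW s0) => /(_ isT).
  rewrite (_ : s *: (F x' + h *m J) + _ = F x' + (s *: h) *m J); last first.
    rewrite -scalemxAl; move: (h *m J) => hJ.
    by apply/rowP => i; rewrite !mxE; ring.
  have := ler_wpM2l M0 str1; rewrite normrZ (gtr0_norm s0).
  move: lip1 sub1; set P1 := Phi _; set P2 := Phi _; set P3 := Phi _; set P4 := Phi _.
  set N1 := `|_ - _ - _|; move: (dot v' h) (`|h|) (normr_ge0 h) => d nh nh0 lip1 sub1 h2 cv.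
  have ee : e' * (s * nh) <= e * (s * nh) by rewrite ler_wpM2r// mulr_ge0// ltW.
  by rewrite -(ler_pM2l s0); lra.
have := lip (F x') (F x); have := lip (F x' + h *m J) (F x + h *m J).
rewrite opprD addrACA subrr addr0 (distrC (F x')) => lip1 lip2.
have := lip (F x) (F x'); move=> lip3.
have := dot_norm (v - v') h; rewrite dotBl ler_norml => /andP[_].
have : n%:R * `|v - v'| * `|h| <= n%:R * e * `|h|.
  by rewrite ler_wpM2r// ler_wpM2l// distrC; lra.
have := ler_wpM2l M0 str2; move: eK; rewrite /K.
move: key lip1 lip2 lip3; set P1 := Phi _; set P2 := Phi _; set P3 := Phi _; set P4 := Phi _.
move: (dot v' h) (dot v h) => d d'; lra.
Qed.
End LimitSubgradient.

(** * Lower limits and filters *)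

Section LowerLimits.
Context {R : realType}.
Local Open Scope ereal_scope.

Lemma lee_real_dense (c s : \bar R) :
  (forall r : R, r%:E < c -> r%:E <= s) -> c <= s.
Proof.
move: c s => [c| |] [s| |] // cs; rewrite ?leey ?leNye//.
- rewrite lee_fin leNgt; apply/negP => sc.
  have := cs ((s + c) / 2)%R; rewrite lte_fin lee_fin midf_lt// => /(_ isT).
  by rewrite leNgt midf_lt.
- by have := cs (c - 1)%R; rewrite lte_fin ltrBlDr ltrDl ltr01 => /(_ isT).
- by have := cs (s + 1)%R; rewrite ltry lee_fin => /(_ isT); rewrite gerDl leNgt ltr01.
- by have := cs 0%R; rewrite ltry => /(_ isT).
Qed.

Lemma limf_einf_gt {T : choiceType} {X : filteredType T} (f : X -> \bar R)
  (F : set_system X) (r : R) : Filter F ->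
  r%:E < limf_einf f F -> \forall x \near F, r%:E < f x.
Proof.
move=> FF; rewrite limf_einfE => /ereal_sup_gt[_ [V FV <-] rV].
apply: filterS FV => x Vx; apply: lt_le_trans rV _.
by apply: ereal_inf_lbound; exists x.
Qed.

Lemma limf_einf_ge {T : choiceType} {X : filteredType T} (f : X -> \bar R)
  (F : set_system X) (r : \bar R) : Filter F ->
  (\forall x \near F, r <= f x) -> r <= limf_einf f F.
Proof.
move=> FF Fr; rewrite limf_einfE; apply: le_trans (ereal_sup_ubound _); last first.
  by exists [set x | r <= f x].
by apply: le_ereal_inf_tmp => _ [x xr <-].
Qed.

(** Testing real r below c covers infinite c as well; the slack e is what absorbs the errors made in
    transferring a curve. *)
Lemma limf_einf_lub {T : choiceType} {X : filteredType T} (f : X -> \bar R)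
  (F : set_system X) (c : \bar R) : Filter F ->
  (forall r e : R, r%:E < c -> (0 < e)%R -> \forall x \near F, (r - e)%:E <= f x) ->
  c <= limf_einf f F.
Proof.
move=> FF h; apply: lee_real_dense => r rc; apply/lee_subgt0Pr => e e0.
by rewrite -EFinB; apply: limf_einf_ge; exact: h.
Qed.

Lemma limf_einf_lt {T : choiceType} {X : filteredType T} (f : X -> \bar R)
  (F : set_system X) (c : \bar R) (P : X -> Prop) : Filter F ->
  limf_einf f F < c -> (\forall x \near F, P x) -> exists x, P x /\ f x < c.
Proof.
move=> FF fc FP; apply: contrapT => /forallNP no; move: fc; apply/negP.
rewrite -leNgt; apply: limf_einf_ge; apply: filterS FP => x Px.
by rewrite leNgt; apply/negP => fxc; exact: (no x).
Qed.

(** Valid for infinite e too, so that difference quotients can be cleared without separating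
    cases. *)
Lemma quotient_ge (e : \bar R) (a r s : R) : (0 < s)%R ->
  (r%:E <= (e - a%:E) * (s^-1)%:E) = ((a + r * s)%:E <= e).
Proof.
move=> s0; move: e => [e| |] /=.
- by rewrite -EFinB -EFinM !lee_fin ler_pdivlMr// lerBrDl.
- by rewrite gt0_mulye ?lte_fin ?invr_gt0// !leey.
- by rewrite gt0_mulNye ?lte_fin ?invr_gt0// !leeNy_eq.
Qed.

Lemma quotient_le (e : \bar R) (a r s : R) : (0 < s)%R ->
  ((e - a%:E) * (s^-1)%:E <= r%:E) = (e <= (a + r * s)%:E).
Proof.
move=> s0; move: e => [e| |] /=.
- by rewrite -EFinB -EFinM !lee_fin ler_pdivrMr// lerBlDl.
- by rewrite gt0_mulye ?lte_fin ?invr_gt0// !leye_eq.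
- by rewrite gt0_mulNye ?lte_fin ?invr_gt0// !leNye.
Qed.

Lemma quotient_pinfty (e : \bar R) (a s : R) : (0 < s)%R ->
  (e - a%:E) * (s^-1)%:E < +oo -> e < +oo.
Proof.
move=> s0; case: e => [e _|/=|_]; rewrite ?ltry//.
by rewrite gt0_mulye// lte_fin invr_gt0.
Qed.

End LowerLimits.

(** * Epsilon forms of limits and diagonal choices *)

Section Neighborhoods.
Context {R : realType}.

Lemma nbhs_normP n (x : 'rV[R]_n) (P : 'rV[R]_n -> Prop) :
  (\forall y \near x, P y) <-> exists2 r : R, 0 < r & forall y, `|y - x| < r -> P y.
Proof.
split=> [/nbhs_ballP[r /= r0 rP]|[r r0 rP]].
  by exists r => // y yx; apply: rP; rewrite -ball_normE/= distrC.
by apply/nbhs_ballP; exists r => //= y; rewrite -ball_normE/= distrC; exact: rP.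
Qed.

Lemma dnbhs_normP n (x : 'rV[R]_n) (P : 'rV[R]_n -> Prop) :
  (\forall y \near x^', P y) <->
  exists2 r : R, 0 < r & forall y, `|y - x| < r -> y != x -> P y.
Proof. by rewrite -nbhs_normP. Qed.

Lemma right_normP (P : R -> Prop) :
  (\forall t \near 0^'+, P t) <-> exists2 r : R, 0 < r & forall t, 0 < t < r -> P t.
Proof.
split=> [/nbhs_ballP[r /= r0 rP]|[r r0 rP]].
  exists r => // t /andP[t0 tr]; apply: rP => //.
  by rewrite /ball/= sub0r normrN gtr0_norm.
apply/nbhs_ballP; exists r => //= t; rewrite /ball/= sub0r normrN => tr t0.
by apply: rP; rewrite t0/=; apply: le_lt_trans tr; exact: ler_norm.
Qed.

Lemma right_prodP n (z : 'rV[R]_n) (P : R * 'rV[R]_n -> Prop) :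
  (\forall p \near filter_prod 0^'+ (nbhs z), P p) <->
  exists2 r : R, 0 < r & forall t y, 0 < t < r -> `|y - z| < r -> P (t, y).
Proof.
split=> [[[A B] /= [/right_normP[r r0 rA] /nbhs_normP[s s0 sB]] AB]|[r r0 rP]].
  exists (Num.min r s) => [|t y /andP[t0]]; first by rewrite lt_min r0.
  rewrite !lt_min => /andP[tr ts] /andP[yr ys]; apply: AB; split=> /=.
    by apply: rA; rewrite t0.
  exact: sB.
exists ([set t | 0 < t < r], [set y | `|y - z| < r]) => /=.
  by split; [apply/right_normP; exists r|apply/nbhs_normP; exists r].
by move=> [t y] /= [tr yr]; exact: rP.
Qed.

Lemma seq_normP n (xk : nat -> 'rV[R]_n) (x : 'rV[R]_n) :
  xk @ \oo --> x <->
  forall e : R, 0 < e -> \forall k \near \oo, `|xk k - x| < e.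
Proof.
split=> [/cvgrPdist_lt h e e0|h]; first by near do rewrite distrC; exact: h.
by apply/cvgrPdist_lt => e e0; near do rewrite distrC; exact: h.
Unshelve. all: by end_near. Qed.

Lemma down_to0P (t : nat -> R) : down_to0 t <->
  (forall k, 0 < t k) /\ forall e : R, 0 < e -> \forall k \near \oo, t k < e.
Proof.
split=> -[t0 h]; split=> //.
  move=> e e0; move/cvgr0Pnorm_lt: h => /(_ e e0); apply: filterS => k.
  by rewrite gtr0_norm.
apply/cvgr0Pnorm_lt => e /h; apply: filterS => k; by rewrite gtr0_norm.
Qed.

Lemma near_invS (e : R) : 0 < e -> \forall k \near \oo, k.+1%:R^-1 < e.
Proof. by move=> e0; exact: near_infty_natSinv_lt (PosNum e0). Qed.

(** Brings tangent cones and second-order tangent sets, defined through sequences, into the epsilon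
    form in which [curve_cluster] compares them. *)
Lemma cluster_sequence n (z : 'rV[R]_n) (P : R -> 'rV[R]_n -> Prop) :
  (exists (t : nat -> R) (zk : nat -> 'rV[R]_n),
     [/\ down_to0 t, zk @ \oo --> z & forall k, P (t k) (zk k)]) <->
  (forall e : R, 0 < e -> exists t y, [/\ 0 < t < e, `|y - z| < e & P t y]).
Proof.
split=> [[t [zk [/down_to0P[t0 th] /seq_normP zh tP]]] e e0|h].
  have [k [? ?]] : exists k, t k < e /\ `|zk k - z| < e.
    have /filter_ex[k [? ?]] : \forall k \near \oo, t k < e /\ `|zk k - z| < e.
      by apply: filterI; [exact: th|exact: zh].
    by exists k.
  by exists (t k), (zk k); rewrite t0.
have /choice[p pP] : forall k : nat, exists p : R * 'rV[R]_n,
    [/\ 0 < p.1 < k.+1%:R^-1, `|p.2 - z| < k.+1%:R^-1 & P p.1 p.2].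
  by move=> k; have [|t [y ?]] := h k.+1%:R^-1; [rewrite invr_gt0|exists (t, y)].
exists (fun k => (p k).1), (fun k => (p k).2); split.
- apply/down_to0P; split=> [k|e /near_invS]; first by case: (pP k) => /andP[].
  by apply: filterS => k; apply: lt_trans; case: (pP k) => /andP[].
- apply/seq_normP => e /near_invS; apply: filterS => k; apply: lt_trans.
  by case: (pP k).
- by move=> k; case: (pP k).
Qed.

(* For each t the parameter e of P is taken nearly optimal, within tau t. *)
Lemma diagonal_choice {T : Type} {Z : Type} (F : set_system T) {FF : Filter F}
    (tau : T -> R) (P : R -> T -> Z -> Prop) (z0 : Z) :
  (forall e : R, 0 < e -> \forall t \near F, 0 < tau t < e) ->
  (forall e e' t z, e <= e' -> P e t z -> P e' t z) ->
  (forall e : R, 0 < e -> \forall t \near F, exists z, P e t z) ->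
  exists zeta : T -> Z, forall e : R, 0 < e -> \forall t \near F, P e t (zeta t).
Proof.
move=> tau0 Pmono Pex.
pose S t := [set e : R | 0 < e /\ exists z, P e t z].
have /choice[zeta zetaP] : forall t, exists z, 0 < tau t -> S t !=set0 ->
    exists2 e : R, e < inf (S t) + tau t & P e t z.
  move=> t; have [[tau_gt0 St0]|no] := pselect (0 < tau t /\ S t !=set0); last first.
    by exists z0 => ? ?; exfalso; apply: no.
  have infS : has_inf (S t) by split=> //; exists 0 => e [/ltW].
  have [e [e0 [z Pz]] ez] := inf_adherent tau_gt0 infS.
  by exists z => _ _; exists e.
exists zeta => e e0; have e20 : 0 < e / 2 by rewrite divr_gt0.
apply: filterS (filterI (tau0 _ e20) (Pex _ e20)) => t [/andP[t0 te] Pe].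
have St : S t (e / 2) by [].
have [e' e'lt] := zetaP t t0 (ex_intro _ _ St).
apply: Pmono; apply: ltW; apply: lt_le_trans e'lt _.
have : inf (S t) <= e / 2 by apply: ge_inf => //; exists 0 => x [/ltW].
lra.
Qed.

End Neighborhoods.

(** * Transfer between the curves of psi and those of g *)

Section Composite.
Context {R : realType} {n m : nat}.
Implicit Types (psi : 'rV[R]_n -> \bar R) (g : 'rV[R]_m -> \bar R).
Implicit Types (F : 'rV[R]_n -> 'rV[R]_m) (x z w : 'rV[R]_n) (y : 'rV[R]_m).

(** The data of the composition with one common radius rho, in the sup norm. Subregularity carries a
    slack eta because the distance to dom psi need not be attained. *)
Record composite_at psi g F xbar (J : 'M[R]_(n, m)) (rho K l : R) : Prop := {
  comp_rho : 0 < rho;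
  comp_K : 0 <= K;
  comp_l : 0 <= l;
  comp_Ny : nowhereNy g;
  comp_eq : forall x, `|x - xbar| < rho -> psi x = g (F x);
  comp_subreg : forall x, `|x - xbar| < rho -> forall y, edom g y ->
    forall eta : R, 0 < eta ->
      exists x', edom psi x' /\ `|x - x'| <= K * `|F x - y| + eta;
  comp_lip : forall y y', edom g y -> edom g y' ->
    `|y - F xbar| < rho -> `|y' - F xbar| < rho ->
    `|fine (g y) - fine (g y')| <= l * `|y - y'|;
  comp_strict : forall e : R, 0 < e -> exists2 r : R, 0 < r & forall a d,
    `|a - xbar| < r -> `|a + d - xbar| < r ->
    `|F (a + d) - F a - d *m J| <= e * `|d| }.

(* Along x = a t + s t *: z' the map F follows b t + s t *: zhat up to o(s t);
   s t = t gives the first-order and s t = t ^ 2 / 2 the second-order theory. *)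
Record curve_data F xbar (a : R -> 'rV[R]_n) (b : R -> 'rV[R]_m) (s : R -> R)
    z zhat : Prop := {
  curve_s : forall t, 0 < t -> 0 < s t;
  curve_small : forall e : R, 0 < e -> exists2 r : R, 0 < r & forall t, 0 < t < r ->
    s t < e /\ `|a t - xbar| < e;
  curve_exp : forall e : R, 0 < e -> exists2 r : R, 0 < r & forall t z',
    0 < t < r -> `|z' - z| < r ->
    `|F (a t + s t *: z') - b t - s t *: zhat| <= e * s t }.

Variables (psi : 'rV[R]_n -> \bar R) (g : 'rV[R]_m -> \bar R).
Variables (F : 'rV[R]_n -> 'rV[R]_m) (xbar : 'rV[R]_n) (J : 'M[R]_(n, m)).
Variables (rho K l : R).
Hypothesis comp : composite_at psi g F xbar J rho K l.

Lemma edom_fineK y : edom g y -> g y = (fine (g y))%:E.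
Proof.
move=> gy; rewrite fineK// fin_numE (comp_Ny _ _ _ _ _ _ _ _ comp y)/=.
by rewrite -ltey.
Qed.

Lemma comp_lipschitz : exists r L : R, [/\ 0 < r, 0 <= L & forall x x',
  `|x - xbar| < r -> `|x' - xbar| < r -> `|F x - F x'| <= L * `|x - x'|].
Proof.
have [r r0 rP] := comp_strict _ _ _ _ _ _ _ _ comp 1 ltr01.
exists r, (1 + n%:R * `|J|); split=> //.
move=> x x' xr x'r.
have E : x' + (x - x') = x by rewrite addrC subrK.
have xr' : `|x' + (x - x') - xbar| < r by rewrite E.
have := rP x' (x - x') x'r xr'; rewrite E.
have := @mulmx_norm R n m (x - x') J.
move=> h1 h2; rewrite -(subrK ((x - x') *m J) (F x - F x')).
by apply: le_trans (ler_normD _ _) _; lra.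
Qed.

Lemma comp_continuous (e : R) : 0 < e -> exists2 r : R, 0 < r &
  forall x, `|x - xbar| < r -> `|F x - F xbar| < e.
Proof.
move=> e0; have [r [L [r0 L0 lip]]] := comp_lipschitz.
have L1 : 0 < L + 1 by rewrite ltr_wpDl.
exists (Num.min r (e / (L + 1))); first by rewrite lt_min r0 divr_gt0.
move=> x; rewrite lt_min ltr_pdivlMr// => /andP[xr xe].
have := lip x xbar xr; rewrite subrr normr0 => /(_ r0).
by have := normr_ge0 (x - xbar); lra.
Qed.

Section Curve.
Variables (a : R -> 'rV[R]_n) (b : R -> 'rV[R]_m) (s : R -> R).
Variables (z : 'rV[R]_n) (zhat : 'rV[R]_m).
Hypothesis cur : curve_data F xbar a b s z zhat.

Lemma curve_point (B e : R) : 0 <= B -> 0 < e -> exists2 r : R, 0 < r &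
  forall t z', 0 < t < r -> `|z'| <= B -> `|a t + s t *: z' - xbar| < e.
Proof.
move=> B0 e0; have e'0 : 0 < e / (B + 1) by rewrite divr_gt0// ltr_wpDl.
have eE : e / (B + 1) * (B + 1) = e by rewrite divfK// gt_eqF// ltr_wpDl.
have [r r0 rP] := curve_small _ _ _ _ _ _ _ cur _ e'0.
exists r => // t z' t0r z'B; have [st at_] := rP t t0r.
have st0 : 0 < s t by apply: (curve_s _ _ _ _ _ _ _ cur); case/andP: t0r.
rewrite addrAC; apply: le_lt_trans (ler_normD _ _) _; rewrite normrZ gtr0_norm//.
have : s t * `|z'| <= e / (B + 1) * B by apply: ler_pM => //; exact: ltW.
lra.
Qed.

Lemma curve_lift (e : R) : 0 < e -> exists2 r : R, 0 < r & forall t y,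
  0 < t < r -> `|y - zhat| < r -> edom g (b t + s t *: y) ->
  exists z', [/\ `|z' - z| <= e, edom psi (a t + s t *: z') &
    (psi (a t + s t *: z') <= g (b t + s t *: y) + (e * s t)%:E)%E].
Proof.
move=> e0; have [rho0 K0 l0 _ peq sub lip _] := comp.
(* The expansion of F is used twice. At the lifted direction z', tolerance e2 keeps the loss l * 2 *
   e2 * s t in g below e * s t. At z, tolerance e1 bounds how far subregularity moves the point; it
   is chosen after e2, so that the displacement q keeps z' within the radius r2 belonging to e2. *)
pose e2 := Num.min 1 (e / (2 * (l + 1))).
have l1 : 0 < 2 * (l + 1) by rewrite mulr_gt0// ltr_wpDl.
have e20 : 0 < e2 by rewrite lt_min ltr01 divr_gt0.
have e2e : l * (e2 + e2) <= e.
  have : e2 * (2 * (l + 1)) <= e by rewrite -ler_pdivlMr// ge_min lexx orbT.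
  lra.
have e21 : e2 <= 1 by rewrite ge_min lexx.
have [r2 r20 r2P] := curve_exp _ _ _ _ _ _ _ cur _ e20.
have r220 : 0 < r2 / 2 by rewrite divr_gt0.
have [q [q0 qe qr2 qe2]] := exists_below _ _ _ e0 r220 e20.
have K1 : 0 < 2 * K + 1 by rewrite ltr_wpDl// mulr_ge0.
pose e1 := q / (2 * K + 1).
have e10 : 0 < e1 by rewrite divr_gt0.
have e1q : e1 * (2 * K + 1) = q by rewrite divfK// gt_eqF.
have Ke10 : 0 <= K * e1 by rewrite mulr_ge0// ltW.
have [r1 r10 r1P] := curve_exp _ _ _ _ _ _ _ cur _ e10.
have rho20 : 0 < rho / 2 by rewrite divr_gt0.
have [rF rF0 rFP] := comp_continuous _ rho20.
have B0 : 0 <= `|z| + e by rewrite addr_ge0// ltW.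
have mF0 : 0 < Num.min rho rF by rewrite lt_min rho0.
have [r3 r30 r3P] := curve_point _ _ B0 mF0.
have rho40 : 0 < rho / 4 by rewrite divr_gt0.
have [r4 r40 r4P] := curve_small _ _ _ _ _ _ _ cur _ rho40.
have [r5 [r50 r51 r52 r53]] := exists_below _ _ _ r10 r20 r30.
have [r [r0 r_5 r_4 r_e1]] := exists_below _ _ _ r50 r40 e10.
exists r => // t y /andP[t0 tr] yr gy.
have tr1 : t < r1 by lra.
have tr2 : t < r2 by lra.
have tr3 : t < r3 by lra.
have tr4 : t < r4 by lra.
have ye1 : `|y - zhat| < e1 by lra.
clear r0 r_5 r_4 r_e1 tr yr r50 r51 r52 r53 r30.
have s0 : 0 < s t by exact: (curve_s _ _ _ _ _ _ _ cur).
have [|st _] := r4P t; first by rewrite t0 tr4.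
have zz : `|z - z| < r1 by rewrite subrr normr0.
have exp1 := r1P t z (introT andP (conj t0 tr1)) zz.
have d1 : `|F (a t + s t *: z) - (b t + s t *: y)| <= 2 * e1 * s t.
  rewrite (_ : _ - _ = (F (a t + s t *: z) - b t - s t *: zhat)
    - s t *: (y - zhat)); last by apply/rowP => i; rewrite !mxE; ring.
  apply: le_trans (ler_normB _ _) _; rewrite normrZ (gtr0_norm s0).
  have : s t * `|y - zhat| <= s t * e1 by rewrite ler_wpM2l// ltW.
  lra.
have near z' : `|z'| <= `|z| + e ->
    `|a t + s t *: z' - xbar| < rho /\ `|a t + s t *: z' - xbar| < rF.
  by move=> /(r3P t z' (introT andP (conj t0 tr3))); rewrite lt_min => /andP.
have [nz _] : `|a t + s t *: z - xbar| < rho /\ `|a t + s t *: z - xbar| < rF.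
  by apply: near; rewrite lerDl ltW.
have e1s : 0 < e1 * s t by rewrite mulr_gt0.
(* The slack is proportional to s t, so the total displacement is at most (2 * K + 1) * e1 * s t = q
   * s t. *)
have [x' [psix' dx']] := sub _ nz _ gy _ e1s.
pose z' := (s t)^-1 *: (x' - a t).
have x'E : a t + s t *: z' = x'.
  by rewrite /z' scalerA mulfV ?gt_eqF// scale1r addrC subrK.
have z'z : `|z' - z| <= q.
  rewrite -(ler_pM2l s0) -[in leLHS](gtr0_norm s0) -normrZ.
  rewrite (_ : s t *: (z' - z) = x' - (a t + s t *: z)); last first.
    by rewrite -x'E; apply/rowP => i; rewrite !mxE; ring.
  rewrite distrC; apply: le_trans dx' _.
  rewrite -e1q; have := ler_wpM2l K0 d1; lra.
have z'B : `|z'| <= `|z| + e.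
  rewrite -(subrK z z'); apply: le_trans (ler_normD _ _) _.
  by rewrite addrC lerD2l; exact: le_trans qe.
have [nx' nFx'] := near _ z'B; rewrite x'E in nx' nFx'.
exists z'; rewrite x'E; split => //; first exact: le_trans qe.
have z'r2 : `|z' - z| < r2.
  by apply: le_lt_trans (le_trans z'z qr2) _; rewrite ltr_pdivrMr// ltr_pMr// ltr1n.
have exp2 := r2P t z' (introT andP (conj t0 tr2)) z'r2; rewrite x'E in exp2.
have d2 : `|F x' - (b t + s t *: y)| <= 2 * e2 * s t.
  rewrite (_ : _ - _ = (F x' - b t - s t *: zhat) - s t *: (y - zhat)); last first.
    by apply/rowP => i; rewrite !mxE; ring.
  apply: le_trans (ler_normB _ _) _; rewrite normrZ (gtr0_norm s0).
  have : s t * `|y - zhat| <= s t * e2 by rewrite ler_wpM2l ?(ltW s0)//; lra.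
  lra.
have Fx' := rFP x' nFx'.
have gFx' : edom g (F x') by rewrite /edom /= -(peq _ nx').
have yF : `|b t + s t *: y - F xbar| < rho.
  rewrite -(subrK (F x') (b t + s t *: y)) -addrA.
  apply: le_lt_trans (ler_normD _ _) _; rewrite distrC.
  have : 2 * e2 * s t <= 2 * 1 * (rho / 4) by rewrite !ler_pM// ?mulr_ge0 ?ltW//; lra.
  lra.
rewrite (peq _ nx') (edom_fineK _ gFx') (edom_fineK _ gy) -EFinD lee_fin.
have Fx'r : `|F x' - F xbar| < rho.
  by apply: lt_trans Fx' _; rewrite ltr_pdivrMr// ltr_pMr// ltr1n.
have := lip _ _ gFx' gy Fx'r yF; rewrite ler_norml => /andP[_].
have := ler_wpM2l l0 d2; have := ler_wpM2r (ltW s0) e2e.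
lra.
Qed.

End Curve.
End Composite.

Section CurveTransfer.
Context {R : realType} {n m : nat}.
Variables (psi : 'rV[R]_n -> \bar R) (g : 'rV[R]_m -> \bar R).
Variables (F : 'rV[R]_n -> 'rV[R]_m) (xbar : 'rV[R]_n) (J : 'M[R]_(n, m)).
Variables (rho K l : R).
Hypothesis comp : composite_at psi g F xbar J rho K l.
Variables (a : R -> 'rV[R]_n) (b : R -> 'rV[R]_m) (s : R -> R).
Variables (z : 'rV[R]_n) (zhat : 'rV[R]_m).
Hypothesis cur : curve_data F xbar a b s z zhat.

(** Here y solves F (a t + s t *: z') = b t + s t *: y exactly, so the values agree without any
    error; the expansion of F puts y close to zhat. *)
Lemma curve_push (e : R) : 0 < e -> exists2 r : R, 0 < r & forall t z',
  0 < t < r -> `|z' - z| < r -> exists y, `|y - zhat| <= e /\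
    psi (a t + s t *: z') = g (b t + s t *: y).
Proof.
move=> e0; have [rho0 _ _ _ peq _ _ _] := comp.
have [r1 r10 r1P] := curve_exp _ _ _ _ _ _ _ cur _ e0.
have B0 : 0 <= `|z| + 1 by rewrite addr_ge0.
have [r2 r20 r2P] := curve_point F xbar a b s z zhat cur _ _ B0 rho0.
have [r [r0 rr1 rr2 r_1]] := exists_below _ _ _ r10 r20 ltr01.
exists r => // t z' /andP[t0 tr] z'z.
have s0 : 0 < s t by exact: (curve_s _ _ _ _ _ _ _ cur).
exists ((s t)^-1 *: (F (a t + s t *: z') - b t)); split; last first.
  rewrite scalerA mulfV ?gt_eqF// scale1r [b t + _]addrC subrK; apply: peq; apply: r2P.
    by rewrite t0; lra.
  rewrite -(subrK z z'); apply: le_trans (ler_normD _ _) _; lra.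
rewrite -(ler_pM2l s0).
have -> v : s t * `|v| = `|s t *: v| by rewrite normrZ gtr0_norm.
rewrite scalerBr scalerA mulfV ?gt_eqF// scale1r mulrC; apply: r1P; first by rewrite t0; lra.
by lra.
Qed.

Lemma curve_cluster :
  (forall e : R, 0 < e -> exists t z',
    [/\ 0 < t < e, `|z' - z| < e & edom psi (a t + s t *: z')]) <->
  (forall e : R, 0 < e -> exists t y,
    [/\ 0 < t < e, `|y - zhat| < e & edom g (b t + s t *: y)]).
Proof.
split=> h e e0; have e20 : 0 < e / 2 by rewrite divr_gt0.
- have [r r0 rP] := curve_push _ e20.
  have [q [q0 qe qr _]] := exists_below _ _ _ e0 r0 r0.
  have [t [z' [/andP[t0 tq] z'q dz']]] := h q q0.
  have [||y [ye yE]] := rP t z'; [by rewrite t0; lra|by lra|].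
  by exists t, y; split; [rewrite t0; lra|lra|rewrite /edom/= -yE].
- have [r r0 rP] := curve_lift psi g F xbar J rho K l comp a b s z zhat cur _ e20.
  have [q [q0 qe qr _]] := exists_below _ _ _ e0 r0 r0.
  have [t [y [/andP[t0 tq] yq dy]]] := h q q0.
  have [|||z' [ze dz' _]] := rP t y; [by rewrite t0; lra|by lra|by []|].
  by exists t, z'; split; [rewrite t0; lra|lra|].
Qed.

(** [A] is the part of the difference quotient that depends on t alone: f x for the subderivative, f
    x + t * df for the parabolic one. Lower bounds for psi pass to g through [curve_lift], those for
    g pass to psi through [curve_push]. *)
Lemma curve_limf (A : R -> R) :
  limf_einf (fun p : R * 'rV[R]_n =>
      (psi (a p.1 + s p.1 *: p.2) - (A p.1)%:E) * ((s p.1)^-1)%:E)%E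
    (filter_prod 0^'+ (nbhs z)) =
  limf_einf (fun p : R * 'rV[R]_m =>
      (g (b p.1 + s p.1 *: p.2) - (A p.1)%:E) * ((s p.1)^-1)%:E)%E
    (filter_prod 0^'+ (nbhs zhat)).
Proof.
have s_gt0 := curve_s _ _ _ _ _ _ _ cur.
apply/le_anti/andP; split; apply: limf_einf_lub => c e /limf_einf_gt.
- move=> /right_prodP[r r0 rP] e0.
  have r20 : 0 < r / 2 by rewrite divr_gt0.
  have [e1 [e10 e1e e1r _]] := exists_below _ _ _ e0 r20 r20.
  have [q q0 qP] := curve_lift psi g F xbar J rho K l comp a b s z zhat cur _ e10.
  have [d [d0 dq dr _]] := exists_below _ _ _ q0 r0 r0.
  apply/right_prodP; exists d => // t y /andP[t0 td] yd /=.
  rewrite quotient_ge ?s_gt0//.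
  have [gy|] := pselect (edom g (b t + s t *: y)); last first.
    by move/negP; rewrite -leNgt leye_eq => /eqP ->; rewrite leey.
  have [|||z' [z'e _ lift]] := qP t y; [by rewrite t0; lra|by lra|by []|].
  have := rP t z'; rewrite t0 /= => /(_ _ _)/ltW; rewrite quotient_ge ?s_gt0// => low.
  have {}low : ((A t + c * s t)%:E <= psi (a t + s t *: z'))%E by apply: low; lra.
  have := le_trans low lift; rewrite -leeBlDr//; apply: le_trans.
  rewrite -EFinB lee_fin.
  have : e1 * s t <= e * s t by rewrite ler_wpM2r// ltW// s_gt0.
  lra.
- move=> /right_prodP[r r0 rP] e0.
  have r20 : 0 < r / 2 by rewrite divr_gt0.
  have [q q0 qP] := curve_push _ r20.
  have [d [d0 dq dr _]] := exists_below _ _ _ q0 r0 r0.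
  apply/right_prodP; exists d => // t z' /andP[t0 td] z'd /=.
  have [||y [ye ->]] := qP t z'; [by rewrite t0; lra|by lra|].
  have ty : 0 < t < r by rewrite t0; lra.
  have yr : `|y - zhat| < r by lra.
  have /= /ltW := rP t y ty yr; apply: le_trans.
  by rewrite lee_fin; lra.
Qed.

End CurveTransfer.

(** * The first- and second-order curves *)

Section Curves.
Context {R : realType} {n m : nat}.
Variables (F : 'rV[R]_n -> 'rV[R]_m) (xbar : 'rV[R]_n).

Lemma first_order_curve (w : 'rV[R]_n) : ext_twice_differentiable_map F xbar ->
  curve_data F xbar (fun=> xbar) (fun=> F xbar) id w (w *m 'J F xbar).
Proof.
move=> F2; split=> [t //|e e0|e e0].
  by exists e => // t /andP[_ te]; rewrite subrr normr0.
pose C : R := `|w| + 1 + n%:R * `|'J F xbar|.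
have C0 : 0 < C by rewrite ltr_wpDr ?mulr_ge0// ltr_wpDl.
have e1 : 0 < e / C by rewrite divr_gt0.
have e1E : e / C * C = e by rewrite divfK// gt_eqF.
have [r r0 rP] := map_strict F xbar F2 _ e1.
have w1 : 0 < `|w| + 1 by rewrite ltr_wpDl.
have rw : 0 < r / (`|w| + 1) by rewrite divr_gt0.
have [d [d0 d1 de dr]] := exists_below _ _ _ ltr01 e1 rw.
exists d => // t w' /andP[t0 td] w'w.
have w'1 : `|w'| <= `|w| + 1.
  by rewrite -(subrK w w'); apply: le_trans (ler_normD _ _) _; lra.
have tw' : `|t *: w'| <= t * (`|w| + 1) by rewrite normrZ gtr0_norm// ler_pM2l.
have twr : `|xbar + t *: w' - xbar| < r.
  rewrite addrAC subrr add0r; apply: le_lt_trans tw' _.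
  by rewrite -ltr_pdivlMr//; lra.
have xr : `|xbar - xbar| < r by rewrite subrr normr0.
have := rP xbar (t *: w') xr twr.
rewrite (_ : F (xbar + t *: w') - F xbar - t *: (w *m 'J F xbar) =
  (F (xbar + t *: w') - F xbar - (t *: w') *m 'J F xbar) +
  t *: ((w' - w) *m 'J F xbar)); last first.
  rewrite mulmxBl -scalemxAl; move: (w' *m _) (w *m _) => X Y.
  by apply/rowP => i; rewrite !mxE; ring.
move=> h; apply: le_trans (ler_normD _ _) _; rewrite normrZ (gtr0_norm t0).
have h1 : e / C * `|t *: w'| <= e / C * (t * (`|w| + 1)) by rewrite ler_wpM2l// ltW.
have h2 : t * `|(w' - w) *m 'J F xbar| <= t * (n%:R * `|'J F xbar| * (e / C)).
  rewrite ler_wpM2l ?(ltW t0)//; apply: le_trans (@mulmx_norm R n m _ _) _.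
  by rewrite ler_wpM2l ?mulr_ge0//; lra.
rewrite -[X in _ <= X * _]e1E; move: h h1 h2 e1; rewrite /C.
move: (e / _) => e2; lra.
Qed.

Lemma ext_hessian_map_bound : exists2 C : R, 0 <= C & forall u v : 'rV[R]_n,
  `|ext_hessian_map F xbar u v| <= C * `|u| * `|v|.
Proof.
pose H i := (ext_hessian (fun y => F y 0 i) xbar)^T.
pose C : R := \sum_(i < m) (n%:R * (n%:R * `|H i|)).
have C0 : 0 <= C by apply: sumr_ge0 => i _; rewrite !mulr_ge0.
exists C => // u v; apply: rV_norm_le => [|i]; first by rewrite !mulr_ge0.
rewrite mxE; apply: le_trans (dot_norm _ _) _; rewrite ler_wpM2r//.
apply: (@le_trans _ _ (n%:R * (n%:R * `|H i|) * `|u|)).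
  by rewrite -mulrA ler_wpM2l//; exact: mulmx_norm.
rewrite ler_wpM2r// /C (bigD1 i)//= lerDl; apply: sumr_ge0 => j _.
by rewrite !mulr_ge0.
Qed.

Lemma ext_hessian_mapDl u u' v : ext_hessian_map F xbar (u + u') v =
  ext_hessian_map F xbar u v + ext_hessian_map F xbar u' v.
Proof. by apply/rowP => i; rewrite !mxE mulmxDl dotDl. Qed.

Lemma ext_hessian_mapDr u v v' : ext_hessian_map F xbar u (v + v') =
  ext_hessian_map F xbar u v + ext_hessian_map F xbar u v'.
Proof. by apply/rowP => i; rewrite !mxE dotDr. Qed.

Lemma ext_hessian_mapZ (t : R) u : ext_hessian_map F xbar (t *: u) (t *: u) =
  t ^+ 2 *: ext_hessian_map F xbar u u.
Proof.
by apply/rowP => i; rewrite !mxE -scalemxAl dotZl dotZr mulrA -expr2.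
Qed.

(** The displacement is t *: (w + k) with k = (t / 2) *: z', so the expansion of F is used along
    this ray. The Hessian terms other than H(w, w) contain k, hence are of order t^3, and the linear
    term contributes z' *m J at the scale t^2 / 2. *)
Lemma second_order_curve (w z : 'rV[R]_n) : ext_twice_differentiable_map F xbar ->
  curve_data F xbar (fun t => xbar + t *: w) (fun t => F xbar + t *: (w *m 'J F xbar))
    (fun t => 2^-1 * t ^+ 2) z (z *m 'J F xbar + ext_hessian_map F xbar w w).
Proof.
move=> F2; split=> [t t0|e e0|e e0].
- by rewrite mulr_gt0// exprn_gt0.
- have w1 : 0 < `|w| + 1 by rewrite ltr_wpDl.
  have ew : 0 < e / (`|w| + 1) by rewrite divr_gt0.
  have [d [d0 d1 de dw]] := exists_below _ _ _ ltr01 e0 ew.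
  exists d => // t /andP[t0 td]; split.
    have : t * t <= 1 * t by rewrite ler_wpM2r//; lra.
    by rewrite expr2; lra.
  rewrite addrAC subrr add0r normrZ gtr0_norm//.
  have : t * (`|w| + 1) < e by rewrite -ltr_pdivlMr//; lra.
  lra.
have [C C0 CP] := ext_hessian_map_bound.
pose B := `|w| + `|z| + 1.
have B0 : 0 < B by rewrite ltr_wpDl// addr_ge0.
(* Errors in units of t^2 / 2 and of e / D: 2 * B^2 from the Taylor remainder, n |J| from z' - z,
   and C * B^2 from each of the three Hessian terms containing k. *)
pose D := 2 * B ^+ 2 + n%:R * `|'J F xbar| + 3 * C * B ^+ 2 + 1.
have D0 : 0 < D by rewrite ltr_wpDl// !addr_ge0 ?mulr_ge0// ?exprn_ge0// ltW.
have e1 : 0 < e / D by rewrite divr_gt0.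
have e1E : e / D * D = e by rewrite divfK// gt_eqF.
have [r r0 rP] := map_taylor F xbar F2 _ e1.
have rB : 0 < r / B by rewrite divr_gt0.
have [d [d0 d1 de dr]] := exists_below _ _ _ ltr01 e1 rB.
exists d => // t z' /andP[t0 td] z'z.
have z'B : `|z'| <= `|z| + 1.
  by rewrite -(subrK z z'); apply: le_trans (ler_normD _ _) _; lra.
pose k := (2^-1 * t) *: z'.
have kt : `|k| <= t * B.
  rewrite normrZ gtr0_norm ?mulr_gt0//.
  have : 2^-1 * t * `|z'| <= 2^-1 * t * B.
    apply: ler_wpM2l; first by lra.
    by rewrite /B; have := normr_ge0 w; lra.
  have : 0 <= t * B by rewrite mulr_ge0 ?(ltW t0) ?(ltW B0).
  lra.
have tB : t * B < r by rewrite -ltr_pdivlMr//; lra.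
have kB : `|k| <= B.
  by apply: le_trans kt _; rewrite ler_piMl ?(ltW B0)//; lra.
have wB : `|w| <= B by rewrite /B; have := normr_ge0 z; lra.
have wkB : `|w + k| <= B.
  apply: le_trans (ler_normD _ _) _; rewrite normrZ gtr0_norm ?mulr_gt0//.
  have : 2^-1 * t * `|z'| <= 1 * (`|z| + 1).
    by apply: ler_pM => //; lra.
  by rewrite /B; lra.
have dE : t *: w + (2^-1 * t ^+ 2) *: z' = t *: (w + k).
  by rewrite /k; apply/rowP => i; rewrite !mxE; ring.
have dr' : `|t *: (w + k)| < r.
  rewrite normrZ gtr0_norm//; apply: le_lt_trans tB.
  by rewrite ler_wpM2l// ltW.
have := rP _ dr'; rewrite -(addrA xbar (t *: w)) dE ext_hessian_mapZ.
have -> : ext_hessian_map F xbar (w + k) (w + k) = ext_hessian_map F xbar w w +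
    (ext_hessian_map F xbar w k + ext_hessian_map F xbar k w + ext_hessian_map F xbar k k).
  by rewrite ext_hessian_mapDl !ext_hessian_mapDr !addrA.
have q1 := CP w k; have q2 := CP k w; have q3 := CP k k.
have bnd (u v : 'rV[R]_n) : `|u| <= B -> `|v| <= t * B ->
    C * `|u| * `|v| <= C * B ^+ 2 * t.
  move=> uB vB; have : `|u| * `|v| <= B * (t * B) by apply: ler_pM.
  by move=> /(ler_wpM2l C0); rewrite expr2; lra.
have {}q1 := le_trans q1 (bnd w k wB kt).
have {}q3 := le_trans q3 (bnd k k kB kt).
rewrite mulrAC in q2; have {}q2 := le_trans q2 (bnd w k wB kt).
move: q1 q2 q3; set H1 := ext_hessian_map _ _ _ _; set H2 := ext_hessian_map _ _ _ _.
set H3 := ext_hessian_map _ _ _ _; set H0 := ext_hessian_map _ _ _ _.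
move=> q1 q2 q3 tay.
have q4 := @mulmx_norm R n m (z' - z) ('J F xbar).
have E : F (xbar + t *: (w + k)) - (F xbar + t *: (w *m 'J F xbar)) -
      (2^-1 * t ^+ 2) *: (z *m 'J F xbar + H0) =
    (F (xbar + t *: (w + k)) - F xbar - t *: (w + k) *m 'J F xbar -
       2^-1 *: (t ^+ 2 *: (H0 + (H1 + H2 + H3)))) +
    (2^-1 * t ^+ 2) *: ((z' - z) *m 'J F xbar + (H1 + H2 + H3)).
  rewrite -!scalemxAl mulmxDl mulmxBl /k -!scalemxAl.
  clear q1 q2 q3 q4 tay; move: H0 H1 H2 H3 (w *m _) (z' *m _) (z *m _) (F _) (F _).
  move=> H0 H1 H2 H3 X1 X2 X3 X4 X5.
  by apply/rowP => i; rewrite !mxE; field.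
rewrite E; apply: le_trans (ler_normD _ _) _; rewrite normrZ.
have t2 : 0 < t ^+ 2 by rewrite exprn_gt0.
rewrite (gtr0_norm (_ : 0 < 2^-1 * t ^+ 2)) ?mulr_gt0//.
have p1 : e / D * `|t *: (w + k)| ^+ 2 <= e / D * (t ^+ 2 * B ^+ 2).
  rewrite ler_wpM2l ?(ltW e1)// normrZ gtr0_norm// exprMn ler_pM2l//.
  by rewrite ler_sqr ?nnegrE// ltW.
have p2 : `|(z' - z) *m 'J F xbar + (H1 + H2 + H3)| <=
    (n%:R * `|'J F xbar| + 3 * C * B ^+ 2) * (e / D).
  apply: le_trans (ler_normD _ _) _.
  have h1 : n%:R * `|'J F xbar| * `|z' - z| <= n%:R * `|'J F xbar| * (e / D).
    by rewrite ler_wpM2l ?mulr_ge0//; lra.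
  have h2 : C * B ^+ 2 * t <= C * B ^+ 2 * (e / D).
    by rewrite ler_wpM2l ?mulr_ge0 ?exprn_ge0 ?(ltW B0)//; lra.
  have := ler_normD (H1 + H2) H3; have := ler_normD H1 H2.
  move: q4 q1 q2 q3 h1 h2; move: (e / D) => eD; lra.
rewrite -[X in _ <= X * _]e1E.
have p3 := ler_wpM2l (ltW t2) p2.
have p4 : 0 <= e / D * t ^+ 2 by rewrite mulr_ge0// ltW.
move: tay p1 p3 p4; rewrite /D; set N1 := `|_|; set N2 := `|_| ^+ 2; set N3 := `|_|.
move: (t ^+ 2) (B ^+ 2) (e / _) => T BB eD; lra.
Qed.
End Curves.

(** * Subdifferentials *)

Section Subgradients.
Context {R : realType} {n : nat}.
Implicit Types (f : 'rV[R]_n -> \bar R) (x v y : 'rV[R]_n).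

Lemma sube_real (e : \bar R) (a b : R) : (e - a%:E - b%:E = e - (a + b)%:E)%E.
Proof. by case: e => [e| |] //; rewrite -!EFinB opprD addrA. Qed.

Lemma regular_minorant f x v : f x \is a fin_num -> regular_subdiff f x v ->
  forall e : R, 0 < e -> exists2 r : R, 0 < r & forall y, `|y - x| < r ->
    ((fine (f x) + dot v (y - x) - e * `|y - x|)%:E <= f y)%E.
Proof.
move=> fx [_ lim0] e e0.
have n0 : 0 < n%:R + 1 :> R by rewrite ltr_wpDl.
have e'0 : 0 < e / (n%:R + 1) by rewrite divr_gt0.
have e'E : e / (n%:R + 1) * (n%:R + 1) = e by rewrite divfK// gt_eqF.
have : ((- (e / (n%:R + 1)))%:E < limf_einf (fun y => (f y - f x -
    (dot v (y - x))%:E) * ((enorm (y - x))^-1)%:E) x^')%E.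
  by apply: lt_le_trans lim0; rewrite lte_fin oppr_lt0.
move=> /limf_einf_gt/dnbhs_normP[r r0 rP]; exists r => // y yr.
have [->|yx] := eqVneq y x; first by rewrite subrr dot0r normr0 mulr0 subr0 addr0 fineK.
have := rP y yr yx; have yx0 : 0 < enorm (y - x) by rewrite enorm_gt0// subr_eq0.
rewrite -{1}(fineK fx) sube_real => /ltW; rewrite quotient_ge//.
apply: le_trans; rewrite lee_fin; have := enorm_le_norm (y - x).
move=> /(ler_wpM2l (ltW e'0)); have := mulr_ge0 (ltW e'0) (normr_ge0 (y - x)).
move: e'E; move: (e / _) (enorm _) (dot _ _) => e' N d <-; lra.
Qed.

Lemma minorant_regular f x v : f x \is a fin_num ->
  (forall e : R, 0 < e -> exists2 r : R, 0 < r & forall y, `|y - x| < r ->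
    ((fine (f x) + dot v (y - x) - e * `|y - x|)%:E <= f y)%E) ->
  regular_subdiff f x v.
Proof.
move=> fx low; split; first by rewrite /edom /= ltey_eq fx.
apply: limf_einf_lub => c e c0 e0.
have c0' : 0 < - c by rewrite oppr_gt0 -lte_fin.
have [r r0 rP] := low _ c0'; apply/dnbhs_normP; exists r => // y yr yx.
have yx0 : 0 < enorm (y - x) by rewrite enorm_gt0// subr_eq0.
rewrite -{1}(fineK fx) sube_real quotient_ge//; apply: le_trans (rP y yr).
rewrite lee_fin; have := norm_le_enorm (y - x).
move=> /(ler_wpM2l (ltW c0')); have := mulr_ge0 (ltW e0) (ltW yx0).
move: (enorm _) (dot _ _) => N d; lra.
Qed.

Lemma proximal_regular f x v : f x \is a fin_num ->
  proximal_subdiff f x v -> regular_subdiff f x v.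
Proof.
move=> fx [_ lim]; apply: minorant_regular => // e e0.
have [c] : exists c : R, (c%:E < limf_einf (fun y => (f y - f x -
    (dot v (y - x))%:E) * ((enorm (y - x) ^+ 2)^-1)%:E) x^')%E.
  move: lim; case: (limf_einf _ _) => [L _| _|//].
    by exists (L - 1); rewrite lte_fin ltrBlDr ltrDl.
  by exists 0; rewrite ltry.
move=> /limf_einf_gt/dnbhs_normP[r r0 rP].
pose k := `|c| * (n%:R * n%:R) + 1.
have k0 : 0 < k by rewrite ltr_wpDl// !mulr_ge0.
have ek : 0 < e / k by rewrite divr_gt0.
have ekE : e / k * k = e by rewrite divfK// gt_eqF.
have [q [q0 qr qe _]] := exists_below _ _ _ r0 ek ek.
exists q => // y yq.
have [->|yx] := eqVneq y x; first by rewrite subrr dot0r normr0 mulr0 subr0 addr0 fineK.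
have yx0 : 0 < enorm (y - x) ^+ 2 by rewrite exprn_gt0// enorm_gt0// subr_eq0.
have := rP y (lt_le_trans yq qr) yx.
rewrite -{1}(fineK fx) sube_real => /ltW; rewrite quotient_ge//.
apply: le_trans; rewrite lee_fin.
have N2 : enorm (y - x) ^+ 2 <= n%:R * n%:R * (`|y - x| * `|y - x|).
  rewrite expr2 mulrACA; have := enorm_le_norm (y - x).
  by move=> ?; apply: ler_pM => //; exact: sqrtr_ge0.
have h1 := ler_wpM2l (normr_ge0 c) N2.
have h2 : - `|c| * enorm (y - x) ^+ 2 <= c * enorm (y - x) ^+ 2.
  by rewrite ler_wpM2r ?(ltW yx0)// lerNl ler_normr lexx orbT.
have h3 : k * (`|y - x| * `|y - x|) <= e * `|y - x|.
  rewrite mulrA ler_wpM2r// -ekE mulrC ler_wpM2r ?(ltW k0)//; lra.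
have : 0 <= `|y - x| * `|y - x| by rewrite mulr_ge0.
move: h1 h2 h3; rewrite /k; move: (enorm _ ^+ 2) (dot _ _) (`|_| * `|_|) => N d nn; lra.
Qed.

Lemma minorant_proximal f x v (c : R) : f x \is a fin_num ->
  (exists2 r : R, 0 < r & forall y, `|y - x| < r ->
    ((fine (f x) + dot v (y - x) - c * `|y - x| ^+ 2)%:E <= f y)%E) ->
  proximal_subdiff f x v.
Proof.
move=> fx [r r0 rP]; split; first by rewrite /edom /= ltey_eq fx.
apply: (@lt_le_trans _ _ (- `|c|)%:E); first exact: ltNyr.
apply: limf_einf_ge; apply/dnbhs_normP; exists r => // y yr yx.
have yx0 : 0 < enorm (y - x) ^+ 2 by rewrite exprn_gt0// enorm_gt0// subr_eq0.
rewrite -{1}(fineK fx) sube_real quotient_ge//; apply: le_trans (rP y yr).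
rewrite lee_fin.
have h : `|y - x| ^+ 2 <= enorm (y - x) ^+ 2.
  by rewrite ler_sqr ?nnegrE ?sqrtr_ge0// norm_le_enorm.
have h1 : c * `|y - x| ^+ 2 <= `|c| * `|y - x| ^+ 2.
  by rewrite ler_wpM2r ?sqr_ge0// ler_norm.
have := ler_wpM2l (normr_ge0 c) h; move: h1.
move: (enorm _ ^+ 2) (dot _ _) (`|_| ^+ 2) => N d nn; lra.
Qed.

Lemma regular_limiting f x v : regular_subdiff f x v -> limiting_subdiff f x v.
Proof.
move=> fv; split; first by case: fv.
by exists (fun=> x), (fun=> v); split=> //; exact: cvg_cst.
Qed.

Lemma edom_fin f x : nowhereNy f -> edom f x -> f x \is a fin_num.
Proof. by move=> fN fx; rewrite fin_numE fN -ltey. Qed.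

(** Apply the local minorant at t *: y + (1 - t) *: x with t small, use convexity and divide by t:
    the error is then a fixed small multiple of |y - x|. *)
Lemma regular_convex f x v : nowhereNy f -> convex_ext f -> regular_subdiff f x v ->
  forall y, ((fine (f x) + dot v (y - x))%:E <= f y)%E.
Proof.
move=> fN fconv fv y; have fx := edom_fin f x fN (proj1 fv).
have [fy|] := pselect (edom f y); last first.
  by move/negP; rewrite -leNgt leye_eq => /eqP ->; rewrite leey.
have {}fy := edom_fin f y fN fy.
rewrite -(fineK fy) lee_fin; apply/ler_addgt0Pr => e0 e00.
have nyx : 0 < `|y - x| + 1 by rewrite ltr_wpDl.
have [e2 [e2_gt0 e2E]] : exists e2 : R, 0 < e2 /\ e2 * (`|y - x| + 1) = e0.
  by exists (e0 / (`|y - x| + 1)); rewrite divr_gt0// divfK// gt_eqF.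
have [r r0 rP] := regular_minorant f x v fx fv _ e2_gt0.
have r1 : 0 < r / (`|y - x| + 1) by rewrite divr_gt0.
have [t [t0 t1 tr _]] := exists_below _ _ _ ltr01 r1 r1.
have ty : `|t *: y + (1 - t) *: x - x| < r.
  rewrite (_ : _ - x = t *: (y - x)); last by apply/rowP => i; rewrite !mxE; ring.
  rewrite normrZ gtr0_norm//.
  have : t * (`|y - x| + 1) <= r by rewrite -ler_pdivlMr.
  lra.
have t01 : 0 <= t <= 1 by rewrite t1 ltW.
have := le_trans (rP _ ty) (fconv y x t t01).
rewrite -(fineK fx) -(fineK fy) -!EFinM -EFinD lee_fin !fineK//=.
rewrite (_ : t *: y + _ - x = t *: (y - x)); last first.
  by apply/rowP => i; rewrite !mxE; ring.
rewrite dotZr normrZ (gtr0_norm t0); move: e2E.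
move: (dot _ _) (`|_|) (fine (f y)) (fine (f x)) => d nh a b <- h; rewrite -(ler_pM2l t0).
have := mulr_gt0 t0 e2_gt0; lra.
Qed.

(** The global inequality of [regular_convex] at x_k passes to the limit, because f (x_k) converges
    to f x by definition of a limiting subgradient. *)
Lemma limiting_convex f x v : nowhereNy f -> convex_ext f -> limiting_subdiff f x v ->
  forall y, ((fine (f x) + dot v (y - x))%:E <= f y)%E.
Proof.
move=> fN fconv [xdom [xk [vk [xkx fxk vkv fv]]]] y.
have fx := edom_fin f x fN xdom.
have [fy|] := pselect (edom f y); last first.
  by move/negP; rewrite -leNgt leye_eq => /eqP ->; rewrite leey.
have {}fy := edom_fin f y fN fy.
rewrite -(fineK fy) lee_fin; apply/ler_addgt0Pr => e0 e00.
pose D := n%:R * (`|v| + 1) + n%:R * `|y - x| + 1.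
have D0 : 0 < D by rewrite ltr_wpDl// addr_ge0 ?mulr_ge0 ?addr_ge0.
have e1 : 0 < e0 / D by rewrite divr_gt0.
have e1E : e0 / D * D = e0 by rewrite divfK// gt_eqF.
have [e [e_gt0 ee e_1 _]] := exists_below _ _ _ e1 ltr01 ltr01.
move: fxk; rewrite -(fineK fx) => /fine_cvgP[_ /cvgrPdist_lt/(_ _ e_gt0) h1].
have h2 := proj1 (seq_normP _ _ _) xkx _ e_gt0.
have h3 := proj1 (seq_normP _ _ _) vkv _ e_gt0.
have [k [[fk xkk] vkk]] := filter_ex (filterI (filterI h1 h2) h3).
have := regular_convex f (xk k) (vk k) fN fconv (fv k) y.
rewrite -(fineK fy) lee_fin.
rewrite (_ : dot v (y - x) = dot (vk k) (y - xk k) + dot (vk k) (xk k - x) -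
   dot (vk k - v) (y - x)); last first.
  rewrite !dotBl !dotBr.
  move: (dot v y) (dot v x) (dot (vk k) y) (dot (vk k) (xk k)) (dot (vk k) x).
  by move=> *; lra.
have b1 := dot_norm (vk k) (xk k - x); have b2 := dot_norm (vk k - v) (y - x).
have vkB : `|vk k| <= `|v| + 1.
  by rewrite -(subrK v (vk k)); apply: le_trans (ler_normD _ _) _; lra.
have c1 : n%:R * `|vk k| * `|xk k - x| <= n%:R * (`|v| + 1) * e.
  by rewrite -!mulrA ler_wpM2l// ler_pM//; exact: ltW.
have c2 : n%:R * `|vk k - v| * `|y - x| <= n%:R * `|y - x| * e.
  by rewrite -!mulrA ler_wpM2l// mulrC ler_wpM2l//; exact: ltW.
have := ler_wpM2r (ltW D0) ee; rewrite e1E /D.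
move: fk b1 b2; rewrite /= !ltr_norml !ler_norml => /andP[_ ?] /andP[_ ?] /andP[? _].
lra.
Qed.

End Subgradients.

(** * Chain rule for the subdifferentials *)

Section ChainRule.
Context {R : realType} {n m : nat}.
Variables (psi : 'rV[R]_n -> \bar R) (g : 'rV[R]_m -> \bar R).
Variables (F : 'rV[R]_n -> 'rV[R]_m) (xbar : 'rV[R]_n).
Variables (rho K l : R).
Hypothesis comp : composite_at psi g F xbar ('J F xbar) rho K l.
Hypothesis F2 : ext_twice_differentiable_map F xbar.
Hypothesis gconv : convex_ext g.
Hypothesis psi_Ny : nowhereNy psi.
Hypothesis gF : edom g (F xbar).

Let g_Ny : nowhereNy g. Proof. by case: comp. Qed.
Let rho0 : 0 < rho. Proof. by case: comp. Qed.
Let psiE : psi xbar = g (F xbar).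
Proof. by case: comp => _ _ _ _ + _ _ _; apply; rewrite subrr normr0. Qed.
Let psi_fin : psi xbar \is a fin_num.
Proof. by rewrite psiE; exact: edom_fin. Qed.

Lemma pullback_proximal y : limiting_subdiff g (F xbar) y ->
  proximal_subdiff psi xbar (y *m ('J F xbar)^T).
Proof.
move=> /(limiting_convex _ _ _ g_Ny gconv) ylow.
have [r r0 rP] := map_taylor F xbar F2 1 ltr01.
have [C C0 CP] := ext_hessian_map_bound F xbar.
(* In 1 + C, the 1 is the Taylor tolerance and C bounds the Hessian term; m * |y| comes from pairing
   with y. *)
apply: (@minorant_proximal _ _ _ _ _ (m%:R * `|y| * (1 + C))) => //.
exists (Num.min r rho) => [|x]; first by rewrite lt_min r0 rho0.
rewrite lt_min => /andP[xr xrho].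
have -> : psi x = g (F x) by case: comp => _ _ _ _ + _ _ _; exact.
apply: le_trans (ylow (F x)); rewrite lee_fin psiE.
have := rP (x - xbar) xr; have := CP (x - xbar) (x - xbar).
rewrite (_ : xbar + (x - xbar) = x); last by rewrite addrC subrK.
set H := ext_hessian_map _ _ _ _; rewrite mul1r => HC tay.
have : `|F x - F xbar - (x - xbar) *m 'J F xbar| <= (1 + C) * `|x - xbar| ^+ 2.
  rewrite -(subrK (2^-1 *: H) (F x - F xbar - _)).
  apply: le_trans (ler_normD _ _) _; rewrite normrZ ger0_norm//.
  have := normr_ge0 H; move: HC; rewrite -mulrA -expr2; move: tay.
  move: (`|x - xbar| ^+ 2) => X; lra.
rewrite -dot_mulmx; move: ((x - xbar) *m _) => hJ.
have -> : F x - F xbar = (F x - F xbar - hJ) + hJ by rewrite subrK.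
rewrite dotDr addrK; have := dot_norm y (F x - F xbar - hJ).
rewrite ler_norml => /andP[h1 _].
move=> /(ler_wpM2l (_ : 0 <= m%:R * `|y|)) h2.
have {}h2 := h2 (mulr_ge0 (ler0n _ _) (normr_ge0 _)).
move: h1 h2; move: (dot y (_ - _)) (dot y hJ) => d1 d2; lra.
Qed.

Section Penalization.
Variables (V e : R) (x' v' : 'rV[R]_n) (rad L M : R).
Hypotheses (V0 : 0 <= V) (e0 : 0 < e) (e1 : e <= 1) (v'V : `|v'| <= V) (L0 : 0 <= L).
Hypothesis rad_lip : forall x y, `|x - xbar| < rad -> `|y - xbar| < rad ->
  `|F x - F y| <= L * `|x - y|.
Hypothesis rad_rho : rad <= rho.
Hypothesis rad_F : forall x, `|x - xbar| < rad -> `|F x - F xbar| < rho.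
Hypothesis x'near : `|x' - xbar| < rad.
Hypothesis x'dom : edom psi x'.
Hypothesis v'reg : regular_subdiff psi x' v'.
Hypothesis ME : M = l + K * (n%:R * V + 1 + l * L) + 1.
Let C : set 'rV[R]_m := [set y | edom g y /\ `|y - F xbar| < rho].

(* An infeasible point F (x' + h) is compared, through the metric subregularity
   condition, with a point of dom psi; the slope M pays for the difference. *)
Lemma exact_penalization : exists2 r : R, 0 < r & forall h, `|h| < r ->
  forall y, C y -> fine (g (F x')) + dot v' h - e * `|h| <=
    fine (g y) + M * `|F (x' + h) - y|.
Proof.
move: rad_rho x'near e1 e0 => rr xn ee ee0.
have [_ K0 l0 _ peq sub lip _] := comp.
have psix' : psi x' = g (F x') by apply: peq; exact: lt_le_trans rad_rho.
have gFx' : edom g (F x') by rewrite /edom/= -psix'.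
have psix'_fin := edom_fin psi x' psi_Ny x'dom.
have [r1 r10 r1P] := regular_minorant psi x' v' psix'_fin v'reg e e0.
have gap : 0 < rad - `|x' - xbar| by lra.
have [q [q0 qr1 qgap _]] := exists_below _ _ _ r10 gap gap.
have K1 : 0 < 4 * (K + 1) by rewrite mulr_gt0// ltr_wpDl.
pose sg := q / (4 * (K + 1)).
have sg0 : 0 < sg by rewrite divr_gt0.
have sgE : sg * (4 * (K + 1)) = q by rewrite divfK// gt_eqF.
have D0 : 0 < l * L + n%:R * V + 1 by rewrite ltr_wpDl// addr_ge0// mulr_ge0.
have rD : 0 < sg / (l * L + n%:R * V + 1) by rewrite divr_gt0.
have q40 : 0 < q / 4 by rewrite divr_gt0.
have [r [r0 rq rsg _]] := exists_below _ _ _ q40 rD rD.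
exists r => // h hr y [gy yrho].
have hD : `|h| * (l * L + n%:R * V + 1) < sg by rewrite -ltr_pdivlMr//; lra.
have xx' : `|x' + h - x'| = `|h| by rewrite addrAC subrr add0r.
have xnear : `|x' + h - xbar| < rad.
  by rewrite addrAC; apply: le_lt_trans (ler_normD _ _) _; lra.
set x := x' + h in xx' xnear *.
have dv' u : `|dot v' u| <= n%:R * V * `|u|.
  by apply: le_trans (dot_norm _ _) _; rewrite ler_wpM2r// ler_wpM2l.
have LF := rad_lip x x' xnear x'near; rewrite xx' in LF.
have dvh := dv' h.
have nh := normr_ge0 h.
have KC : 0 <= K * (n%:R * V + 1 + l * L).
  by rewrite mulr_ge0// !addr_ge0// mulr_ge0.
clear rsg rD D0 K1 q40 r0 r10 gap.
(* M has three parts. The part l pays for the variation of g between F x and y. The 1 pays in the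
   far case: all terms of order |h| are below sg, hence below |F x - y|. The part with factor K pays
   in the close case for moving x to x2. *)
have [far|close] := leP sg `|F x - y|.
  have := lip _ _ gFx' gy (rad_F x' x'near) yrho; rewrite ler_norml => /andP[_ h1].
  have := ler_distD (F x) (F x') y; rewrite (distrC (F x') (F x)) => /(ler_wpM2l l0) h2.
  have h3 := ler_wpM2l l0 LF.
  have h4 := mulr_ge0 KC (normr_ge0 (F x - y)).
  have h5 := mulr_ge0 (ltW e0) nh.
  move: dvh; rewrite ler_norml => /andP[_ h6].
  by rewrite ME; lra.
apply/ler_addgt0Pr => e2 e20.
(* The cost per unit of |x - x2|: n * V from v', 1 from the error e <= 1, l * L from g along F.
   Subregularity turns |x - x2| into K * |F x - y| up to eta. *)
pose D := n%:R * V + 1 + l * L.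
have D00 : 0 < D + 1 by rewrite ltr_wpDl// !addr_ge0// mulr_ge0.
have e2D : 0 < e2 / (D + 1) by rewrite divr_gt0.
have [eta [eta0 etasg etae _]] := exists_below _ _ _ sg0 e2D e2D.
have etaD : eta * (D + 1) <= e2 by rewrite -ler_pdivlMr.
have [x2 [psix2 dx2]] := sub x (lt_le_trans xnear rad_rho) y gy eta eta0.
have Ksg : K * `|F x - y| <= K * sg by rewrite ler_wpM2l// ltW.
have Ksg0 : 0 <= K * sg by rewrite mulr_ge0// ltW.
have x2x' : `|x2 - x'| <= `|h| + `|x - x2|.
  have := ler_distD x x2 x'; rewrite xx' (distrC x2 x); lra.
have x2q : `|x2 - x'| < q by lra.
have x2near : `|x2 - xbar| < rad.
  by have := ler_distD x' x2 xbar; lra.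
have psix2E : psi x2 = g (F x2) by apply: peq; exact: lt_le_trans rad_rho.
have gFx2 : edom g (F x2) by rewrite /edom/= -psix2E.
have := r1P x2 (lt_le_trans x2q qr1).
rewrite psix' psix2E -(fineK (edom_fin _ _ g_Ny gFx2)) lee_fin /=.
have -> : x2 - x' = h - (x - x2).
  by rewrite /x; apply/rowP => i; rewrite !mxE; ring.
have -> : `|h - (x - x2)| = `|x2 - x'|.
  by congr `|_|; rewrite /x; apply/rowP => i; rewrite !mxE; ring.
rewrite dotBr => low.
have := lip _ _ gFx2 gy (rad_F x2 x2near) yrho; rewrite ler_norml => /andP[_ h1].
have := ler_distD (F x) (F x2) y; rewrite (distrC (F x2) (F x)) => /(ler_wpM2l l0) h2.
have h3 := ler_wpM2l l0 (rad_lip x x2 xnear x2near).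
have := dv' (x - x2); rewrite ler_norml => /andP[_ h4].
have h5 : e * `|x2 - x'| <= e * `|h| + `|x - x2|.
  have : e * `|x2 - x'| <= e * (`|h| + `|x - x2|) by rewrite ler_wpM2l// ltW.
  have : e * `|x - x2| <= 1 * `|x - x2| by rewrite ler_wpM2r.
  lra.
have h6 : D * `|x - x2| <= D * (K * `|F x - y| + eta).
  by rewrite ler_wpM2l// /D !addr_ge0// mulr_ge0.
have h7 := normr_ge0 (F x - y).
move: low h4 h5 h6 etaD; rewrite ME /D.
move: (dot v' h) (dot v' _) => d1 d2; lra.
Qed.

End Penalization.

Lemma limiting_pushforward v : limiting_subdiff psi xbar v ->
  exists2 y, limiting_subdiff g (F xbar) y & y *m ('J F xbar)^T = v.
Proof.
have [_ K0 l0 _ peq _ lip strict] := comp.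
move=> [_ [xk [vk [xkx _ vkv vreg]]]].
have [r1 [L [r10 L0 Flip]]] := comp_lipschitz psi g F xbar _ rho K l comp.
have [r2 r20 r2P] := comp_continuous psi g F xbar _ rho K l comp rho rho0.
have [rad [rad0 rad1 rad2 radr]] := exists_below _ _ _ r10 r20 rho0.
(* V bounds the v_k close to v, so that M can be fixed before k is chosen. *)
pose V := `|v| + 1.
have V0 : 0 <= V by rewrite addr_ge0.
pose M := l + K * (n%:R * V + 1 + l * L) + 1.
have lM : l <= M.
  rewrite /M -addrA lerDl addr_ge0// mulr_ge0// !addr_ge0// mulr_ge0//.
have M0 : 0 <= M := le_trans l0 lM.
pose C : set 'rV[R]_m := [set y | edom g y /\ `|y - F xbar| < rho].
pose gr y := fine (g y).
have gE y : edom g y -> g y = (gr y)%:E by move=> gy; rewrite /gr fineK//; exact: edom_fin.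
have C0 : C (F xbar) by split; rewrite // subrr normr0.
have gr_lip y z : C y -> C z -> `|gr y - gr z| <= l * `|y - z|.
  by move=> [gy yr] [gz zr]; exact: lip.
have gtz y z (t : R) : C y -> C z -> 0 <= t <= 1 ->
    (g (t *: y + (1 - t) *: z) <= (t * gr y + (1 - t) * gr z)%:E)%E.
  move=> [gy _] [gz _] t01; apply: le_trans (gconv y z t t01) _.
  by rewrite (gE _ gy) (gE _ gz) -!EFinM -EFinD.
have C_convex y z (t : R) : C y -> C z -> 0 <= t <= 1 -> C (t *: y + (1 - t) *: z).
  move=> Cy Cz t01; split.
    by apply: le_lt_trans (gtz y z t Cy Cz t01) _; exact: ltry.
  have := segment_norm z (y - z) (F xbar) rho t (proj2 Cz) _ t01.
  rewrite (_ : z + t *: (y - z) = t *: y + (1 - t) *: z); last first.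
    by apply/rowP => i; rewrite !mxE; ring.
  apply; rewrite (_ : z + (y - z) = y); first by case: Cy.
  by rewrite addrC subrK.
have gr_convex y z (t : R) : C y -> C z -> 0 <= t <= 1 ->
    gr (t *: y + (1 - t) *: z) <= t * gr y + (1 - t) * gr z.
  move=> Cy Cz t01; rewrite -lee_fin -gE; first exact: gtz.
  by case: (C_convex y z t Cy Cz t01).
pose Phi := lipschitz_regularization C gr M.
have Phi_id y : C y -> Phi y = gr y.
  by move=> Cy; apply: (@lipschitz_regularization_id _ _ C gr l M (F xbar)).
have Phi_convex : convex_fun Phi.
  exact: (@lipschitz_regularization_convex _ _ C gr l M (F xbar)).
have Phi_lip y z : Phi y <= Phi z + M * `|y - z|.
  exact: (@lipschitz_regularization_lip _ _ C gr l M (F xbar)).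
have Phi_ge y c : (forall z, C z -> c <= gr z + M * `|y - z|) -> c <= Phi y.
  exact: (@lipschitz_regularization_ge _ _ C gr l M (F xbar)).
have : forall h, Phi (F xbar) + dot v h <= Phi (F xbar + h *m 'J F xbar).
  apply: (@limit_subgradient _ _ _ F ('J F xbar) Phi M xbar v strict) => // e e0.
  have [e1 [e10 e1e e1_1 e1rad]] := exists_below _ _ _ e0 ltr01 rad0.
  have h1 := proj1 (seq_normP _ _ _) xkx _ e10.
  have h2 := proj1 (seq_normP _ _ _) vkv _ e10.
  have [k [xkk vkk]] := filter_ex (filterI h1 h2).
  exists (xk k), (vk k); split; [lra|lra|].
  have xkrad : `|xk k - xbar| < rad by lra.
  have vkV : `|vk k| <= V.
    by rewrite -(subrK v (vk k)); apply: le_trans (ler_normD _ _) _; rewrite /V; lra.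
  have radlip x y : `|x - xbar| < rad -> `|y - xbar| < rad ->
      `|F x - F y| <= L * `|x - y| by move=> xr yr; apply: Flip; lra.
  have radF x : `|x - xbar| < rad -> `|F x - F xbar| < rho.
    by move=> xr; apply: r2P; lra.
  have xkdom : edom psi (xk k) by case: (vreg k).
  have [r r0 rP] := exact_penalization V e1 (xk k) (vk k) rad L M V0 e10 e1_1 vkV L0
    radlip radr radF xkrad xkdom (vreg k) erefl.
  have CFx : C (F (xk k)).
    split; last exact: radF.
    by rewrite /edom/= -peq//; lra.
  exists r => // h hr; apply: Phi_ge => y Cy; rewrite (Phi_id _ CFx).
  have := rP h hr y Cy; have : e1 * `|h| <= e * `|h| by rewrite ler_wpM2r.
  by rewrite /gr; move: (dot _ _) => d; lra.
move=> /(subgradient_chain _ _ _ _ _ _ Phi_convex)[y [vE ysub]].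
exists y => //; apply: regular_limiting; apply: minorant_regular.
  exact: edom_fin.
(* Phi agrees with g on C, so the subgradient inequality of Phi gives that of g on this ball; off
   dom g the value of g is +oo. *)
move=> e e0; exists rho => // z zrho.
have [gz|] := pselect (edom g z); last first.
  by move/negP; rewrite -leNgt leye_eq => /eqP ->; rewrite leey.
rewrite (gE _ gz) lee_fin; have Cz : C z by [].
have := ysub (z - F xbar); rewrite (_ : F xbar + (z - F xbar) = z); last first.
  by rewrite addrC subrK.
rewrite (Phi_id _ Cz) (Phi_id _ C0) /gr; have := mulr_ge0 (ltW e0) (normr_ge0 (z - F xbar)).
by move: (dot _ _) => d; lra.
Qed.

Lemma subdifferential_chain :
  proximal_subdiff psi xbar = limiting_subdiff psi xbar /\
  limiting_subdiff psi xbar =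
    [set y *m ('J F xbar)^T | y in limiting_subdiff g (F xbar)].
Proof.
have pl v : proximal_subdiff psi xbar v -> limiting_subdiff psi xbar v.
  by move=> /(proximal_regular _ _ _ psi_fin)/regular_limiting.
split; apply/seteqP; split=> v.
- exact: pl.
- by move=> /limiting_pushforward[y gy <-]; exact: pullback_proximal.
- by move=> /limiting_pushforward[y gy <-]; exists y.
- by move=> [y gy <-]; apply: pl; exact: pullback_proximal.
Qed.

End ChainRule.

(** * Second-order calculus *)

Section Data.
Context {R : realType} {n m : nat}.

Lemma composite_atP (psi : 'rV[R]_n -> \bar R) (g : 'rV[R]_m -> \bar R)
    (F : 'rV[R]_n -> 'rV[R]_m) (xbar : 'rV[R]_n) :
  (\forall x \near xbar, psi x = g (F x)) ->
  ext_twice_differentiable_map F xbar -> nowhereNy g ->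
  lipschitz_rel_dom g (F xbar) ->
  (exists kappa : R, 0 <= kappa /\
     \forall x \near xbar,
       (dist_set x (edom psi) <= kappa%:E * dist_set (F x) (edom g))%E) ->
  exists rho K l, composite_at psi g F xbar ('J F xbar) rho K l.
Proof.
move=> /nbhs_normP[r1 r10 r1P] F2 gN [l [l0 [U [/nbhs_normP[r2 r20 r2P] lip]]]].
move=> [kappa [k0 /nbhs_normP[r3 r30 r3P]]].
have [rho [rho0 rho1 rho2 rho3]] := exists_below _ _ _ r10 r20 r30.
exists rho, (kappa * m%:R), (l * m%:R); split=> //.
- by rewrite mulr_ge0.
- by rewrite mulr_ge0.
- by move=> x xr; apply: r1P; lra.
- move=> x xr y gy eta eta0.
  have : (dist_set x (edom psi) < (kappa * m%:R * `|F x - y| + eta)%:E)%E.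
    apply: le_lt_trans (r3P x _) _; first by lra.
    apply: (@le_lt_trans _ _ (kappa%:E * (enorm (F x - y))%:E)%E).
      rewrite lee_wpmul2l ?lee_fin//; apply: ereal_inf_lbound.
      by exists y.
    rewrite -EFinM lte_fin; have := ler_wpM2l k0 (enorm_le_norm (F x - y)); lra.
  move=> /ereal_inf_lt[_ [x' psix' <-]]; rewrite lte_fin => /ltW h.
  by exists x'; split=> //; apply: le_trans h; exact: norm_le_enorm.
- move=> y y' gy gy' yr y'r.
  have Uy : U y by apply: r2P; lra.
  have Uy' : U y' by apply: r2P; lra.
  have := lip y y' (conj gy Uy) (conj gy' Uy').
  rewrite -(fineK (edom_fin _ _ gN gy)) -(fineK (edom_fin _ _ gN gy')) /=.
  rewrite lee_fin => /le_trans; apply; rewrite -mulrA ler_wpM2l//.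
  exact: enorm_le_norm.
- exact: map_strict.
Qed.

End Data.

(** * Parabolic subderivatives and second-order tangent sets *)

Section Parabolic.
Context {R : realType} {n : nat}.
Implicit Types (f : 'rV[R]_n -> \bar R) (x w z : 'rV[R]_n).

Lemma parabola_small (B e : R) : 0 <= B -> 0 < e -> exists2 r : R, 0 < r &
  forall x w y (t : R), `|w| <= B -> `|y| <= B -> 0 < t < r ->
    `|x + t *: w + (2^-1 * t ^+ 2) *: y - x| < e.
Proof.
move=> B0 e0; have D0 : 0 < 2 * B + 1 by rewrite ltr_wpDl// mulr_ge0.
have eD : 0 < e / (2 * B + 1) by rewrite divr_gt0.
have [r [r0 r1 re _]] := exists_below _ _ _ ltr01 eD eD.
exists r => // x w y t wB yB /andP[t0 tr].
rewrite (_ : _ - x = t *: w + (2^-1 * t ^+ 2) *: y); last first.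
  by apply/rowP => i; rewrite !mxE; ring.
apply: le_lt_trans (ler_normD _ _) _; rewrite normrZ (normrZ _ y) (gtr0_norm t0).
have t2 : 0 <= 2^-1 * t ^+ 2 by rewrite mulr_ge0// sqr_ge0.
rewrite (ger0_norm t2).
have t2t : 2^-1 * t ^+ 2 <= t.
  have : t * t <= 1 * t by rewrite ler_wpM2r//; lra.
  by rewrite expr2; lra.
have h1 : t * `|w| <= t * B by rewrite ler_wpM2l// ltW.
have h2 : 2^-1 * t ^+ 2 * `|y| <= t * B by apply: ler_pM.
have : t * (2 * B + 1) < e by rewrite -ltr_pdivlMr//; lra.
lra.
Qed.

Lemma parabolic_quotientE f x w (c d t : R) z :
  f x = c%:E -> subderivative f x w = d%:E ->
  parabolic_quotient f x w t z =
    ((f (x + t *: w + (2^-1 * t ^+ 2) *: z)%R - (c + t * d)%:E) *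
     ((2^-1 * t ^+ 2)^-1)%:E)%E.
Proof. by move=> fx fd; rewrite /parabolic_quotient fx fd -EFinM sube_real. Qed.

Lemma half_sqr_gt0 (t : R) : 0 < t -> 0 < 2^-1 * t ^+ 2.
Proof. by move=> t0; rewrite mulr_gt0// exprn_gt0. Qed.

Lemma second_orderP (Omega : set 'rV[R]_n) x w z :
  second_order_tangent_set Omega x w z <->
  forall e : R, 0 < e -> exists t z', [/\ 0 < t < e, `|z' - z| < e &
    Omega (x + t *: w + (2^-1 * t ^+ 2) *: z')].
Proof.
exact: (cluster_sequence _ _ (fun t z' => Omega (x + t *: w + (2^-1 * t ^+ 2) *: z'))).
Qed.

Lemma parabolic_sequence_ge f x w z (t : nat -> R) (zk : nat -> 'rV[R]_n) :
  down_to0 t -> zk @ \oo --> z ->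
  (parabolic_subderivative f x w z <=
   limn_einf (fun k => parabolic_quotient f x w (t k) (zk k)))%E.
Proof.
move=> /down_to0P[t0 tlim] /seq_normP zlim.
rewrite -[limn_einf _]/(limf_einf _ \oo); apply: limf_einf_lub => r e.
move=> /limf_einf_gt/right_prodP[d d0 dP] e0.
apply: filterS (filterI (tlim _ d0) (zlim _ d0)) => k [tk zkz].
have /= /ltW := dP (t k) (zk k) (introT andP (conj (t0 k) tk)) zkz.
by apply: le_trans; rewrite lee_fin; lra.
Qed.

Lemma parabolic_dom_tangent f x w z (c d : R) :
  f x = c%:E -> subderivative f x w = d%:E ->
  (parabolic_subderivative f x w z < +oo)%E ->
  second_order_tangent_set (edom f) x w z.
Proof.
move=> fx fd dom; apply/second_orderP => e e0.
have near_e : \forall p \near filter_prod 0^'+ (nbhs z),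
    0 < p.1 < e /\ `|p.2 - z| < e.
  by apply/right_prodP; exists e.
have [[t z'] [/= [te ze]]] := limf_einf_lt _ _ _ _ _ dom near_e.
rewrite (parabolic_quotientE _ _ _ _ _ _ _ fx fd) => q.
exists t, z'; split=> //; apply: quotient_pinfty q.
by apply: half_sqr_gt0; case/andP: te.
Qed.

Section RelativelyLipschitz.
Variables (f : 'rV[R]_n -> \bar R) (x w : 'rV[R]_n) (c d rho l : R).
Hypotheses (rho0 : 0 < rho) (l0 : 0 <= l) (f_Ny : nowhereNy f).
Hypothesis f_lip : forall y y', edom f y -> edom f y' ->
    `|y - x| < rho -> `|y' - x| < rho ->
    `|fine (f y) - fine (f y')| <= l * `|y - y'|.
Hypotheses (fx : f x = c%:E) (fd : subderivative f x w = d%:E).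
Hypothesis epi : parabolically_epi_differentiable f x w.

(** Epi-differentiability supplies, for one u0 in the domain and the very sequence t_k that realizes
    z, directions u_k with quotients below a constant infinitely often. Both curve points lie in dom
    f at distance t_k^2 / 2 * |z_k - u_k|, so the Lipschitz bound carries the estimate over to
    z_k. *)
Lemma parabolic_tangent_dom z : second_order_tangent_set (edom f) x w z ->
  (parabolic_subderivative f x w z < +oo)%E.
Proof.
move=> [t [zk [tdown zkz zdom]]].
have [_ [[u0 u0dom] epi_seq]] := epi.
have [uk [uku lim_u]] := epi_seq u0 t tdown.
have [C uC] : exists C : R, (parabolic_subderivative f x w u0 < C%:E)%E.
  move: u0dom; rewrite /edom/=; case: (parabolic_subderivative _ _ _ _) => [q _|//|_].
    by exists (q + 1); rewrite lte_fin ltrDl.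
  by exists 0; exact: ltNyr.
rewrite lim_u -[limn_einf _]/(limf_einf _ \oo) in uC.
(* The 2 covers the distances of z_k to z and of u_k to u0, each below 1. *)
pose C' := C + l * (`|z - u0| + 2).
suff : (parabolic_subderivative f x w z <= C'%:E)%E.
  by move=> /le_lt_trans; apply; exact: ltry.
rewrite leNgt; apply/negP => /limf_einf_gt/right_prodP[r r0 rP].
have [tpos tlim] := proj1 (down_to0P _) tdown.
pose B := `|w| + `|z| + `|u0| + 1.
have B0 : 0 <= B by rewrite !addr_ge0.
have [q q0 qP] := parabola_small _ _ B0 rho0.
have [e [e0 er eq e1]] := exists_below _ _ _ r0 q0 ltr01.
have near_k : \forall k \near \oo,
    (t k < e /\ `|zk k - z| < e) /\ `|uk k - u0| < e.
  apply: filterI; last exact: (proj1 (seq_normP _ _ _) uku).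
  by apply: filterI; [exact: tlim|exact: (proj1 (seq_normP _ _ _) zkz)].
have [k [[[tk zk_z] uk_u]]] := limf_einf_lt _ _ _ _ _ uC near_k.
have s0 := half_sqr_gt0 _ (tpos k).
rewrite (parabolic_quotientE _ _ _ _ _ _ _ fx fd) => /ltW.
rewrite quotient_le// => fu.
have udom : edom f (x + t k *: w + (2^-1 * t k ^+ 2) *: uk k).
  by apply: le_lt_trans fu _; exact: ltry.
have nw := normr_ge0 w; have nz := normr_ge0 z; have nu := normr_ge0 u0.
have wB : `|w| <= B by rewrite /B; lra.
have zB : `|zk k| <= B.
  by rewrite -(subrK z (zk k)); apply: le_trans (ler_normD _ _) _; rewrite /B; lra.
have uB : `|uk k| <= B.
  by rewrite -(subrK u0 (uk k)); apply: le_trans (ler_normD _ _) _; rewrite /B; lra.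
have tq : 0 < t k < q by rewrite tpos; lra.
have tr : 0 < t k < r by rewrite tpos; lra.
have zr : `|zk k - z| < r by lra.
have := rP (t k) (zk k) tr zr.
rewrite /= (parabolic_quotientE _ _ _ _ _ _ _ fx fd); apply/negP; rewrite -leNgt.
rewrite quotient_le//.
have := f_lip _ _ (zdom k) udom (qP x w (zk k) (t k) wB zB tq)
  (qP x w (uk k) (t k) wB uB tq).
rewrite (_ : _ - _ = (2^-1 * t k ^+ 2) *: (zk k - uk k)); last first.
  by apply/rowP => i; rewrite !mxE; ring.
rewrite normrZ (gtr0_norm s0) ler_norml => /andP[_ h1].
move: fu; rewrite -(fineK (edom_fin _ _ f_Ny udom)).
rewrite -(fineK (edom_fin _ _ f_Ny (zdom k))) !lee_fin => fu.
have : `|zk k - uk k| <= `|z - u0| + 2.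
  rewrite (_ : zk k - uk k = (zk k - z) + (z - u0) - (uk k - u0)); last first.
    by apply/rowP => i; rewrite !mxE; ring.
  apply: le_trans (ler_normB _ _) _; have := ler_normD (zk k - z) (z - u0); lra.
move=> /(ler_wpM2l l0)/(ler_wpM2l (ltW s0)); rewrite /C'.
move: h1 fu; move: (2^-1 * t k ^+ 2) => s; lra.
Qed.

(* Parabolic epi-differentiability upgrades "for some t_k" to "for all small t". *)
Lemma tangent_near z : second_order_tangent_set (edom f) x w z ->
  forall e : R, 0 < e -> \forall t \near 0^'+, exists y, `|y - z| < e /\
    edom f (x + t *: w + (2^-1 * t ^+ 2) *: y).
Proof.
move=> /parabolic_tangent_dom zdom e e0; apply: contrapT => no.
have /choice[t tP] : forall k : nat, exists t : R, 0 < t < k.+1%:R^-1 /\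
    ~ exists y, `|y - z| < e /\ edom f (x + t *: w + (2^-1 * t ^+ 2) *: y).
  move=> k; apply: contrapT => /forallNP nok; apply: no; apply/right_normP.
  exists k.+1%:R^-1 => [|t tk]; first by rewrite invr_gt0.
  by have := nok t; move=> /not_andP[//|/contrapT].
have tdown : down_to0 t.
  apply/down_to0P; split=> [k|d' d'0]; first by case: (tP k) => /andP[].
  apply: filterS (near_invS _ d'0) => k; apply: lt_trans.
  by case: (tP k) => /andP[].
have [_ [_ epi_seq]] := epi.
have [yk [ykz lim_y]] := epi_seq z t tdown.
rewrite lim_y -[limn_einf _]/(limf_einf _ \oo) in zdom.
have [k [yk_z]] := limf_einf_lt _ _ _ _ _ zdom (proj1 (seq_normP _ _ _) ykz _ e0).
have [/andP[tk0 _] nok] := tP k.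
rewrite (parabolic_quotientE _ _ _ _ _ _ _ fx fd) => q; apply: nok.
by exists (yk k); split=> //; apply: quotient_pinfty q; exact: half_sqr_gt0.
Qed.

End RelativelyLipschitz.

(** Compactness of a cube, phrased with an arbitrary eventual property P so that no subsequence has
    to be extracted. *)
Lemma bounded_cluster (zk : nat -> 'rV[R]_n) (B : R) : (forall k, `|zk k| <= B) ->
  exists z, forall (P : nat -> Prop) (e : R), 0 < e -> (\forall k \near \oo, P k) ->
    exists k, P k /\ `|zk k - z| < e.
Proof.
move=> zB.
have cpt := @rV_compact R n (fun=> [set` `[- B, B]]) (fun=> segment_compact (a := - B) (b := B)).
have [|z [_ zcl]] := cpt (zk @ \oo) _.
  exists 0%N => // k _ i /=; rewrite in_itv/= -ler_norml.
  by apply: le_trans (zB k); exact: mx_norm_ge.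
exists z => P e e0 nearP.
have [||_ [[k Pk <-] kz]] := zcl (zk @` P) (ball z e).
- by apply: filterS nearP => k Pk; exists k.
- by apply/nbhs_ballP; exists e.
by exists k; split=> //; move: kz; rewrite -ball_normE/= distrC.
Qed.

(** A diagonal choice gives directions zeta t converging to z, and x + t *: w + (t^2 / 2) *: zeta t
    is the required arc. *)
Lemma parabolically_derivable_near (Omega : set 'rV[R]_n) x w : Omega x ->
  second_order_tangent_set Omega x w !=set0 ->
  (forall z, second_order_tangent_set Omega x w z ->
    forall e : R, 0 < e -> \forall t \near 0^'+, exists y, `|y - z| <= e /\
      Omega (x + t *: w + (2^-1 * t ^+ 2) *: y)) ->
  parabolically_derivable Omega x w.
Proof.
move=> Ox ne near_z; split=> // z /near_z{}near_z.
have tau0 (e : R) : 0 < e -> \forall t \near 0^'+, 0 < (t : R) < e.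
  by move=> e0; apply/right_normP; exists e.
have [|zeta zetaP] := diagonal_choice 0^'+ id (fun e t y => `|y - z| <= e /\
    Omega (x + t *: w + (2^-1 * t ^+ 2) *: y)) (0 : 'rV[R]_n) tau0 _ near_z.
  by move=> e e' t y ee' [ye Oy]; split=> //; exact: le_trans ee'.
pose xi (t : R) := x + t *: w + (2^-1 * t ^+ 2) *: zeta t.
have xi0 : xi 0 = x by rewrite /xi scale0r expr0n/= mulr0 scale0r !addr0.
have /right_normP[r1 r10 r1P] := zetaP 1 ltr01.
(* [r1P] covers an open interval, while xi must stay in Omega on a closed one. *)
exists (r1 / 2), xi; split=> //.
- by rewrite divr_gt0.
- move=> t /andP[]; rewrite le_eqVlt => /orP[/eqP <- _|t0 tr]; first by rewrite xi0.
  by have [|_ //] := r1P t; rewrite t0; lra.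
- apply/cvgrPdist_lt => e e0; apply/right_normP.
  have D0 : 0 < `|z| + 1 by rewrite ltr_wpDl.
  have eD : 0 < e / (`|z| + 1) by rewrite divr_gt0.
  have [r [r0 rr1 re _]] := exists_below _ _ _ r10 eD eD.
  exists r => // t /andP[t0 tr]; rewrite xi0.
  have [|zt _] := r1P t; first by rewrite t0; lra.
  rewrite (_ : w - _ = (- (2^-1 * t)) *: zeta t); last first.
    rewrite /xi; apply/rowP => i; rewrite !mxE; field; exact: lt0r_neq0.
  rewrite normrZ normrN gtr0_norm ?mulr_gt0//.
  have : `|zeta t| <= `|z| + 1.
    by rewrite -(subrK z (zeta t)); apply: le_trans (ler_normD _ _) _; lra.
  move=> /(ler_wpM2l (ltW t0)).
  have : t * (`|z| + 1) < e by rewrite -ltr_pdivlMr//; lra.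
  have := mulr_ge0 (ltW t0) (normr_ge0 (zeta t)).
  lra.
- apply/cvgrPdist_lt => e e0; have e20 : 0 < e / 2 by rewrite divr_gt0.
  have /right_normP[r r0 rP] := zetaP _ e20; apply/right_normP; exists r => // t t0r.
  have [zt _] := rP t t0r; have t0 : 0 < t by case/andP: t0r.
  rewrite xi0 (_ : _ *: (xi t - x - t *: w) = zeta t); last first.
    rewrite /xi; apply/rowP => i; rewrite !mxE; field; exact: lt0r_neq0.
  by rewrite distrC; lra.
Qed.

End Parabolic.

(** * Chain rules of first and second order *)

Section ParabolicChain.
Context {R : realType} {n m : nat}.
Variables (psi : 'rV[R]_n -> \bar R) (g : 'rV[R]_m -> \bar R).
Variables (F : 'rV[R]_n -> 'rV[R]_m) (xbar : 'rV[R]_n).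
Variables (rho K l c : R).
Hypothesis comp : composite_at psi g F xbar ('J F xbar) rho K l.
Hypothesis F2 : ext_twice_differentiable_map F xbar.
Hypothesis (psix : psi xbar = c%:E) (gFx : g (F xbar) = c%:E).
Local Notation J := ('J F xbar).
Local Notation H := (ext_hessian_map F xbar).

Lemma subderivative_chain w :
  subderivative psi xbar w = subderivative g (F xbar) (w *m J).
Proof.
rewrite /subderivative psix gFx.
exact: (curve_limf _ _ _ _ _ _ _ _ comp _ _ _ _ _ (first_order_curve F xbar w F2) (fun=> c)).
Qed.

Lemma tangent_cone_chain w :
  tangent_cone (edom psi) xbar w <-> tangent_cone (edom g) (F xbar) (w *m J).
Proof.
apply: iff_trans (cluster_sequence _ _ (fun t v => edom psi (xbar + t *: v))) _.
apply: iff_trans (iff_sym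
  (cluster_sequence _ _ (fun t v => edom g (F xbar + t *: v)))).
exact: (curve_cluster _ _ _ _ _ _ _ _ comp _ _ _ _ _ (first_order_curve F xbar w F2)).
Qed.

Lemma second_order_chain w z :
  second_order_tangent_set (edom psi) xbar w z <->
  second_order_tangent_set (edom g) (F xbar) (w *m J) (z *m J + H w w).
Proof.
apply: iff_trans (second_orderP _ _ _ _) _.
apply: iff_trans (iff_sym (second_orderP _ _ _ _)).
exact: (curve_cluster _ _ _ _ _ _ _ _ comp _ _ _ _ _ (second_order_curve F xbar w z F2)).
Qed.

Variables (w : 'rV[R]_n) (d : R).
Hypothesis gd : subderivative g (F xbar) (w *m J) = d%:E.
Hypothesis epi : parabolically_epi_differentiable g (F xbar) (w *m J).

Let psid : subderivative psi xbar w = d%:E.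
Proof. by rewrite subderivative_chain. Qed.

Lemma parabolic_subderivative_chain z :
  parabolic_subderivative psi xbar w z =
  parabolic_subderivative g (F xbar) (w *m J) (z *m J + H w w).
Proof.
rewrite /parabolic_subderivative.
under eq_fun do rewrite (parabolic_quotientE _ _ _ _ _ _ _ psix psid).
rewrite (curve_limf _ _ _ _ _ _ _ _ comp _ _ _ _ _ (second_order_curve F xbar w z F2)
  (fun t => c + t * d)).
by under [in RHS]eq_fun do rewrite (parabolic_quotientE _ _ _ _ _ _ _ gFx gd).
Qed.

Lemma parabolic_domain_chain :
  edom (parabolic_subderivative psi xbar w) =
  second_order_tangent_set (edom psi) xbar w.
Proof.
have [rho0 _ l0 gN _ _ lip _] := comp.
apply/seteqP; split=> z.
  exact: (parabolic_dom_tangent _ _ _ _ _ _ psix psid).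
move=> /second_order_chain Tz; rewrite /edom/= parabolic_subderivative_chain.
exact: (parabolic_tangent_dom _ _ _ _ _ _ _ rho0 l0 gN lip gFx gd epi).
Qed.

(** For u0 tangent to dom g the equation z *m J + H w w = u0 may have no solution. Subregularity at
    xbar + t_k *: w, with the point of dom g on the curve of u_k as target, gives points of dom psi
    whose corrections z_k at the scale t_k^2 / 2 are bounded; any cluster point of them is a tangent
    vector. *)
Lemma second_order_nonempty : second_order_tangent_set (edom psi) xbar w !=set0.
Proof.
have [rho0 K0 _ _ _ sub _ _] := comp.
have [_ [[u0 u0dom] _]] := epi.
have [t [uk [tdown uku udom]]] := parabolic_dom_tangent _ _ _ _ _ _ gFx gd u0dom.
have [tpos tlim] := proj1 (down_to0P _) tdown.
have cur := second_order_curve F xbar w 0 F2; rewrite mul0mx add0r in cur.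
have [r1 r10 r1P] := curve_exp _ _ _ _ _ _ _ cur 1 ltr01.
have [r2 r20 r2P] := curve_small _ _ _ _ _ _ _ cur _ rho0.
have [r [r0 rr1 rr2 _]] := exists_below _ _ _ r10 r20 r20.
(* In units of t_k^2 / 2 the distance from F to its target is at most 1 for the expansion of F plus
   |H w w| + |u0| + 1 for H w w - u_k; the slack of subregularity turns K * B into K * B + 1. *)
pose B := `|H w w| + `|u0| + 2.
have near_k : \forall k \near \oo, t k < r /\ `|uk k - u0| < 1.
  apply: filterI; [exact: tlim|exact: (proj1 (seq_normP _ _ _) uku)].
have [N _ NP] := near_k.
have /choice[z zP] : forall k, exists z, `|z| <= K * B + 1 /\
    edom psi (xbar + t (k + N)%N *: w + (2^-1 * t (k + N)%N ^+ 2) *: z).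
  move=> k0; have [tk uk_u] := NP (k0 + N)%N (leq_addl _ _).
  move: (k0 + N)%N tk uk_u => k tk uk_u.
  have s0 := half_sqr_gt0 _ (tpos k).
  have tk1 : 0 < t k < r1 by rewrite tpos; lra.
  have tk2 : 0 < t k < r2 by rewrite tpos; lra.
  have [_ ak] := r2P _ tk2.
  have z0 : `|0 - 0 : 'rV[R]_n| < r1 by rewrite subrr normr0.
  have := r1P _ 0 tk1 z0; rewrite scaler0 addr0 mul1r => e1.
  have [x' [psix' dx']] := sub _ ak _ (udom k) _ s0.
  exists ((2^-1 * t k ^+ 2)^-1 *: (x' - (xbar + t k *: w))); split; last first.
    by rewrite scalerA mulfV ?gt_eqF// scale1r addrC subrK.
  rewrite normrZ gtr0_norm ?invr_gt0// ler_pdivrMl// distrC.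
  apply: le_trans dx' _; rewrite mulrDr mulr1 lerD2r [leRHS]mulrCA ler_wpM2l//.
  rewrite (_ : _ - _ = (F (xbar + t k *: w) - (F xbar + t k *: (w *m J)) -
    (2^-1 * t k ^+ 2) *: H w w) + (2^-1 * t k ^+ 2) *: (H w w - uk k)); last first.
    by move: (w *m J) (H w w) => *; apply/rowP => i; rewrite !mxE; ring.
  apply: le_trans (ler_normD _ _) _; rewrite (normrZ _ (H w w - uk k)) (gtr0_norm s0).
  have : `|H w w - uk k| <= `|H w w| + `|u0| + 1.
    apply: le_trans (ler_normB _ _) _.
    by have := ler_normD (uk k - u0) u0; rewrite subrK; lra.
  by move=> /(ler_wpM2l (ltW s0)); rewrite /B; lra.
have [zlim zclu] := bounded_cluster z _ (fun k => proj1 (zP k)).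
exists zlim; apply/second_orderP => e e0.
have near_t : \forall k \near \oo, t (k + N)%N < e.
  have [N' _ N'P] := tlim _ e0; exists N' => // k /= kN'.
  by apply: N'P => /=; apply: leq_trans kN' _; exact: leq_addr.
have [k [tk zk]] := zclu _ _ e0 near_t.
by exists (t (k + N)%N), (z k); rewrite tpos; split=> //; case: (zP k).
Qed.

Lemma parabolically_derivable_chain : parabolically_derivable (edom psi) xbar w.
Proof.
have [rho0 _ l0 gN _ _ lip _] := comp.
apply: parabolically_derivable_near; last 2 first.
- exact: second_order_nonempty.
- move=> z /second_order_chain Tz e e0.
  have [r r0 rP] := curve_lift _ _ _ _ _ _ _ _ comp _ _ _ _ _
    (second_order_curve F xbar w z F2) _ e0.
  have := tangent_near _ _ _ _ _ _ _ rho0 l0 gN lip gFx gd epi _ Tz _ r0.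
  move=> /right_normP[r' r'0 r'P]; apply/right_normP.
  have [q [q0 qr qr' _]] := exists_below _ _ _ r0 r'0 r'0.
  exists q => // t /andP[t0 tq].
  have [|y [yr gy]] := r'P t; first by rewrite t0; lra.
  have [|||z' [z'z psiz' _]] := rP t y; [by rewrite t0; lra|by []|by []|].
  by exists z'.
- by rewrite /edom/= psix ltry.
Qed.

(** A recovery sequence of g at z *m J + H w w is lifted term by term, with errors made to tend to 0
    by [diagonal_choice]; the lower bound holds along every sequence. *)
Lemma parabolically_epi_differentiable_chain :
  parabolically_epi_differentiable psi xbar w.
Proof.
split; first by rewrite psid.
split; first by rewrite parabolic_domain_chain; exact: second_order_nonempty.
move=> z t tdown; have [tpos tlim] := proj1 (down_to0P _) tdown.
have [_ [_ epi_seq]] := epi.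
have [yk [ykz lim_y]] := epi_seq (z *m J + H w w) t tdown.
(* The value estimate is conditional because a recovery sequence may leave dom g for some k; there
   the quotient of g is +oo and any z' close to z will do. *)
pose P (e : R) (k : nat) (z' : 'rV[R]_n) := `|z' - z| <= e /\
  (edom g (F xbar + t k *: (w *m J) + (2^-1 * t k ^+ 2) *: yk k)%R ->
   psi (xbar + t k *: w + (2^-1 * t k ^+ 2) *: z')%R <=
   g (F xbar + t k *: (w *m J) + (2^-1 * t k ^+ 2) *: yk k)%R +
     (e * (2^-1 * t k ^+ 2))%:E)%E.
have [|||zk zkP] := diagonal_choice \oo (fun k => k.+1%:R^-1) P z.
- by move=> e e0; apply: filterS (near_invS _ e0) => k ke; rewrite invr_gt0 ltr0n.
- move=> e e' k z' ee' [z'z h]; split; first exact: le_trans ee'.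
  move=> /h/le_trans; apply; rewrite leeD2l// lee_fin.
  by rewrite ler_wpM2r// ltW// half_sqr_gt0.
- move=> e e0.
  have [r r0 rP] := curve_lift _ _ _ _ _ _ _ _ comp _ _ _ _ _
    (second_order_curve F xbar w z F2) _ e0.
  apply: filterS (filterI (tlim _ r0) (proj1 (seq_normP _ _ _) ykz _ r0)) => k [tk yk_z].
  have [gy|ngy] := pselect (edom g (F xbar + t k *: (w *m J) +
      (2^-1 * t k ^+ 2) *: yk k)); last first.
    by exists z; split=> //; rewrite subrr normr0 ltW.
  have [|||z' [z'z _ h]] := rP (t k) (yk k); [by rewrite tpos|by []|by []|].
  by exists z'.
have zkz : zk @ \oo --> z.
  apply/seq_normP => e e0; have e20 : 0 < e / 2 by rewrite divr_gt0.
  by apply: filterS (zkP _ e20) => k [zke _]; lra.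
exists zk; split=> //; apply/le_anti/andP; split.
  exact: parabolic_sequence_ge.
rewrite parabolic_subderivative_chain lim_y.
rewrite -![limn_einf _]/(limf_einf _ \oo); apply: limf_einf_lub => r e.
move=> /limf_einf_gt low e0; apply: filterS (filterI low (zkP _ e0)) => k [].
have s0 := half_sqr_gt0 _ (tpos k).
rewrite (parabolic_quotientE _ _ _ _ _ _ _ psix psid) => /ltW.
rewrite (parabolic_quotientE _ _ _ _ _ _ _ gFx gd) !quotient_ge// => lowk [_ h].
have [gy|] := pselect (edom g (F xbar + t k *: (w *m J) +
      (2^-1 * t k ^+ 2) *: yk k)); last first.
  by move/negP; rewrite -leNgt leye_eq => /eqP ->; rewrite leey.
have := le_trans lowk (h gy); rewrite -leeBlDr//; apply: le_trans.
by rewrite -EFinB lee_fin; move: (2^-1 * _) => s; lra.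
Qed.

End ParabolicChain.

Theorem proposition3p1 (R : realType) (n m : nat)
  (psi : 'rV[R]_n -> \bar R) (xbar : 'rV[R]_n)
  (F : 'rV[R]_n -> 'rV[R]_m) (g : 'rV[R]_m -> \bar R)
  (psi_Ny : nowhereNy psi) (psi_fin : psi xbar \is a fin_num)
  (psi_comp : \forall x \near xbar, psi x = g (F x))
  (F_twice : ext_twice_differentiable_map F xbar)
  (g_proper : proper_ext g) (g_lsc : lower_semicontinuous g)
  (g_convex : convex_ext g) (g_lip : lipschitz_rel_dom g (F xbar))
  (msqc : exists kappa : R, 0 <= kappa /\
     \forall x \near xbar,
       (dist_set x (edom psi) <= kappa%:E * dist_set (F x) (edom g))%E) :
  ((forall w, subderivative psi xbar w =
              subderivative g (F xbar) (w *m 'J F xbar)) /\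
   proximal_subdiff psi xbar = limiting_subdiff psi xbar /\
   limiting_subdiff psi xbar =
     [set y *m ('J F xbar)^T | y in limiting_subdiff g (F xbar)] /\
   tangent_cone (edom psi) xbar =
     [set w | tangent_cone (edom g) (F xbar) (w *m 'J F xbar)]) /\
  (forall w, tangent_cone (edom psi) xbar w ->
     parabolically_epi_differentiable g (F xbar) (w *m 'J F xbar) ->
     ((forall z, second_order_tangent_set (edom psi) xbar w z <->
         second_order_tangent_set (edom g) (F xbar) (w *m 'J F xbar)
           (z *m 'J F xbar + ext_hessian_map F xbar w w)) /\
      parabolically_derivable (edom psi) xbar w) /\
     (forall z, parabolic_subderivative psi xbar w z =
        parabolic_subderivative g (F xbar) (w *m 'J F xbar)
          (z *m 'J F xbar + ext_hessian_map F xbar w w)) /\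
     edom (parabolic_subderivative psi xbar w) =
       second_order_tangent_set (edom psi) xbar w /\
     parabolically_epi_differentiable psi xbar w).
Proof.
have [gN _] := g_proper.
have psiE : psi xbar = g (F xbar) := nbhs_singleton psi_comp.
pose c := fine (psi xbar).
have psix : psi xbar = c%:E by rewrite fineK.
have gFx : g (F xbar) = c%:E by rewrite -psiE.
have gF : edom g (F xbar) by rewrite /edom/= gFx ltry.
have [rho [K [l comp]]] := composite_atP psi g F xbar psi_comp F_twice gN g_lip msqc.
have [prox lim] := subdifferential_chain psi g F xbar rho K l comp F_twice g_convex psi_Ny gF.
split.
  split; first exact: (subderivative_chain _ _ _ _ _ _ _ _ comp F_twice psix gFx).
  split=> //; split=> //; apply/seteqP; split=> w;
    by move=> /(tangent_cone_chain _ _ _ _ _ _ _ comp F_twice).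
move=> w _ epi; have [gd _] := epi.
(* Finiteness of the subderivative is part of parabolic epi-differentiability, so [fine] loses
   nothing. *)
have {}gd : subderivative g (F xbar) (w *m 'J F xbar) =
  (fine (subderivative g (F xbar) (w *m 'J F xbar)))%:E by rewrite fineK.
split; last split; last split.
- split; last exact: (parabolically_derivable_chain _ _ _ _ _ _ _ _ comp F_twice psix gFx _ _ gd epi).
  by move=> z; exact: (second_order_chain _ _ _ _ _ _ _ comp F_twice).
- by move=> z; exact: (parabolic_subderivative_chain _ _ _ _ _ _ _ _ comp F_twice psix gFx _ _ gd).
- exact: (parabolic_domain_chain _ _ _ _ _ _ _ _ comp F_twice psix gFx _ _ gd epi).
- exact: (parabolically_epi_differentiable_chain _ _ _ _ _ _ _ _ comp F_twice psix gFx _ _ gd epi).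
Qed.
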